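(* There is a function $\alpha:(1,3/2)\to(1,\infty)$ such that for every $p\in(1,3/2)$ there exists a function $a\in\mathfrak{A}(1,\alpha(p))$ for which the equation $$u_t=a\,u_{xx}\quad\text{in } Q$$ has a nonzero unbounded solution $u$ in the class $\overset{0}{W}{}^{1,2}_p(Q)$. Furthermore, $\alpha(p)\to1$ as $p\downarrow1$ and $\alpha(p)\to\infty$ as $p\uparrow3/2$.
   Context: $Q=(0,1)\times\mathbb{R}$, with points written $(t,x)$. For $0<\beta\le\alpha<\infty$, $\mathfrak{A}(\beta,\alpha)$ is the set of Borel functions $a(t,x)$ on $Q$ with $\beta\le a(t,x)\le\alpha$ for all $(t,x)\in Q$. For $p\in(1,\infty)$, $W^{1,2}_p$ is the Sobolev space of functions $u(t,x)$ on $\mathbb{R}^2$ such that $u,u_x,u_{xx},u_t\in L_p(\mathbb{R}^2)$, with the usual norm, and $\overset{0}{W}{}^{1,2}_p(Q)$ is the set of restrictions to $Q$ of functions in $W^{1,2}_p$ that are identically zero for $t\le0$. Equations for functions in $\overset{0}{W}{}^{1,2}_p(Q)$ are understood almost everywhere in $Q$. *)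

(* Defs.v *)
From HB Require Import structures.
From mathcomp Require Import all_boot all_order all_algebra.
From mathcomp Require Import all_classical all_reals all_analysis.

Set Implicit Arguments.
Unset Strict Implicit.
Unset Printing Implicit Defensive.

Import Order.TTheory GRing.Theory Num.Theory.
Import numFieldNormedType.Exports.

Local Open Scope classical_set_scope.
Local Open Scope ring_scope.

(* Points of the plane are pairs z = (t, x): z.1 is time, z.2 is space. *)

Definition leb2 (R : realType) :=
  ((@lebesgue_measure R) \x (@lebesgue_measure R))%E.
Arguments leb2 R : clear implicits.

Definition Q (R : realType) : set (R * R) := [set z | 0 < z.1 < 1].
Arguments Q R : clear implicits.

(* Classical partial derivatives, meaningful where the sections are derivable *)
Definition Dt (R : realType) (f : R * R -> R) : R * R -> R :=
  fun z => derive1 (fun t => f (t, z.2)) z.1.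

Definition Dx (R : realType) (f : R * R -> R) : R * R -> R :=
  fun z => derive1 (fun x => f (z.1, x)) z.2.

Fixpoint Ck (R : realType) (n : nat) (f : R * R -> R) : Prop :=
  continuous f /\
  if n is m.+1 then
    [/\ forall z : R * R, derivable (fun t => f (t, z.2)) z.1 1,
        forall z : R * R, derivable (fun x => f (z.1, x)) z.2 1,
        Ck m (Dt f) & Ck m (Dx f)]
  else True.

(* C_c^oo(W): smooth functions with compact support contained in W *)
Definition test_function (R : realType) (W : set (R * R)) (phi : R * R -> R) :=
  [/\ forall n, Ck n phi,
      compact (closure [set z | phi z != 0]) &
      closure [set z | phi z != 0] `<=` W].

(* For W open, integrability on compacts includes measurability on W. *)
Definition loc_integrable (R : realType) (W : set (R * R)) (f : R * R -> R) :=
  forall K : set (R * R), compact K -> K `<=` W ->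
    (leb2 R).-integrable K (EFin \o f).

(* g is the weak partial derivative of u in the open set W; [D] is [@Dt R] or
   [@Dx R].  Only the values of u and g on W matter. *)
Definition weak_deriv (R : realType) (D : (R * R -> R) -> R * R -> R)
    (W : set (R * R)) (u g : R * R -> R) :=
  [/\ loc_integrable W u, loc_integrable W g &
      forall phi, test_function W phi ->
        \int[leb2 R]_(z in W) (u z * D phi z) =
        - \int[leb2 R]_(z in W) (g z * phi z)].

Definition W12 (R : realType) (p : R) (u : R * R -> R) : Prop :=
  exists ut ux uxx : R * R -> R,
    [/\ weak_deriv (@Dt R) setT u ut,
        weak_deriv (@Dx R) setT u ux &
        weak_deriv (@Dx R) setT ux uxx] /\
    [/\ u \in Lfun (leb2 R) p%:E, ux \in Lfun (leb2 R) p%:E,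
        uxx \in Lfun (leb2 R) p%:E & ut \in Lfun (leb2 R) p%:E].

(* A function on Q is represented by a function on the plane whose values
   outside Q are irrelevant. *)
Definition W12_0_Q (R : realType) (p : R) (u : R * R -> R) : Prop :=
  exists U : R * R -> R,
    [/\ W12 p U,
        forall z : R * R, z.1 <= 0 -> U z = 0 &
        forall z, Q R z -> u z = U z].

Definition frakA (R : realType) (b al : R) : set (R * R -> R) :=
  [set a | measurable_fun (Q R) a /\ forall z, Q R z -> b <= a z <= al].

(* u_t = a u_xx almost everywhere in Q *)
Definition solves_in_Q (R : realType) (a u : R * R -> R) : Prop :=
  exists ut ux uxx : R * R -> R,
    [/\ weak_deriv (@Dt R) (Q R) u ut,
        weak_deriv (@Dx R) (Q R) u ux,
        weak_deriv (@Dx R) (Q R) ux uxx &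
        {ae leb2 R, forall z, Q R z -> ut z = a z * uxx z}].

(* Elements of Sobolev spaces are classes modulo null sets, so vanishing and
   boundedness are taken almost everywhere. *)
Definition nonzero_in_Q (R : realType) (u : R * R -> R) : Prop :=
  ~ {ae leb2 R, forall z, Q R z -> u z = 0}.

Definition unbounded_in_Q (R : realType) (u : R * R -> R) : Prop :=
  ~ exists M : R, {ae leb2 R, forall z, Q R z -> `|u z| <= M}.

(* Main.v *)
Require Import Defs.
From HB Require Import structures.
From mathcomp Require Import all_boot all_order all_algebra.
From mathcomp Require Import all_classical all_reals all_analysis.
From mathcomp Require Import measurable_realfun.
From mathcomp Require Import ring lra.

Set Implicit Arguments.
Unset Strict Implicit.
Unset Printing Implicit Defensive.

Import Order.TTheory GRing.Theory Num.Theory.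
Import numFieldNormedType.Exports.

Local Open Scope classical_set_scope.
Local Open Scope ring_scope.

(** The solution is self-similar: for 0 < t <= 1 it is u (t, x) = t^(-h/2) f (xi) with
   xi = lam x / sqrt t, where 0 < h < 1 and f is even, positive and of Gaussian decay.  It is
   unbounded near the origin.  The derivatives u_t and u_xx have the form t^(-h/2-1) k (xi) with k
   of rapid decay, so that the integral of |u_t|^p over x is of order t^(1/2 - (h/2+1) p), and they
   lie in L_p as soon as (h/2+1) p < 3/2 (lemma [dominated_Lfun]).  The value
   h = (3 - 2p)/p^2 has this property for all p in (1, 3/2); it tends to 1 as p tends to 1 and to
   0 as p tends to 3/2.

   The coefficient is found by choosing f first.  With f' = - 2 phi f and lam^2 = h/4, the equation
   u_t = a u_xx says that a = A (xi), where
       xi phi - h/2 = A h (phi^2 - phi'/2).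
   For A to be bounded and bounded away from 0 the two sides must vanish at the same points.  On
   |xi| <= 1 this is achieved by phi = xi / (1 + kappa xi^2) with kappa = (1-h)/h, for which both
   sides are multiples of the same quadratic polynomial and A = 1 + kappa xi^2.  This f decays like
   a power and its A is unbounded.  It is therefore continued for |xi| >= 1, where both sides are
   already positive, by a Gaussian times an exponential, phi = h^2 xi + h (1-h) sgn xi; the
   constants make phi continuous, so that f is of class C^1 with f'' piecewise continuous.  Then
   1 <= A <= (2-h)/h^3 ([profile_ode], [coef_bounds]).  For h = 1 everything degenerates to the heat
   kernel with A = 1, which is why the bound tends to 1 as p tends to 1.

   To obtain a function on the plane, u is multiplied by a Lipschitz cutoff in time, equal to 1 on
   Q, and extended by 0 to t <= 0.  Its weak derivatives are the classical ones: by Fubini it is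
   enough to integrate by parts on lines ([weak_deriv_t], [weak_deriv_x]), and on each line the
   function is made of three pieces of class C^1 ([weak_pair_pieces]).  On the lines x = constant
   with x <> 0 the singularity at t = 0 is invisible, because f decays rapidly
   ([selfsimilar_C1_time]); the line x = 0 is negligible. *)

(** * Measurability on the plane *)

(** The sigma-algebra on the plane is the product one, so that open sets have to be written as
   countable unions of rectangles. *)
Lemma open_measurable2 (R : realType) (A : set (R * R)) : open A -> measurable A.
Proof.
move=> oA.
pose rect (q : (rat * rat) * (rat * rat)) : set (R * R) :=
  `]ratr q.1.1, ratr q.1.2[%classic `*` `]ratr q.2.1, ratr q.2.2[%classic.
have -> : A = \bigcup_q (if `[< rect q `<=` A >] then rect q else set0).
  apply/seteqP; split => [z Az|z [q _]]; last by case: asboolP => [qA /qA|].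
  have /nbhs_ballP[e /= e0 eA] : nbhs z A by exact: open_nbhs_nbhs.
  have bnd (x : R) : exists q : rat * rat,
      [/\ x - e < ratr q.1, ratr q.1 < x, x < ratr q.2 & ratr q.2 < x + e].
    have xl : x - e < x by rewrite ltrBlDr ltrDl.
    have xr : x < x + e by rewrite ltrDl.
    have := rat_in_itvoo xl; have := rat_in_itvoo xr; move=> [b hb] [a ha]; move: ha hb.
    rewrite !in_itv/= => /andP[a1 a2] /andP[b1 b2]; exists (a, b); by split.
  have [q1 [a1 a2 a3 a4]] := bnd z.1.
  have [q2 [b1 b2 b3 b4]] := bnd z.2.
  have sub : rect (q1, q2) `<=` A.
    move=> w -[/=]; rewrite !in_itv/= => /andP[c1 c2] /andP[d1 d2].
    by apply: eA; split; rewrite /= /ball/= ltr_norml; apply/andP; split; lra.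
  exists (q1, q2) => //; rewrite asboolT//.
  by split; rewrite /= in_itv/=; apply/andP.
apply: countable_bigcupT_measurable => [|q]; [exact: countableP|case: asboolP => // _].
by apply: measurableX; exact: measurable_itv.
Qed.

Lemma continuous_measurable2 (R : realType) (f : R * R -> R) :
  continuous f -> measurable_fun setT f.
Proof.
move=> /continuousP cf; apply: (measurability _ (measurable_realfun.RGenOpens.measurableE R)).
move=> _ [_ [a [b ->] <-]]; rewrite setTI; apply: open_measurable2.
exact/cf/interval_open.
Qed.

Lemma compact_measurable2 (R : realType) (A : set (R * R)) : compact A -> measurable A.
Proof.
move=> cA; rewrite -(setCK A); apply: measurableC; apply: open_measurable2.
by apply: closed_openC; apply: compact_closed => //; exact: norm_hausdorff.
Qed.
(** * Integrals of derivatives on the line *)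

Lemma is_derive_continuous (R : realType) (f : R -> R) (x d : R) :
  is_derive x 1 f d -> {for x, continuous f}.
Proof. by case=> /derivable1_diffP /differentiable_continuous. Qed.

Lemma integral_derivative (R : realType) (P p : R -> R) (a b : R) : a < b ->
  (forall x, a <= x <= b -> is_derive x 1 P (p x)) ->
  (forall x, a <= x <= b -> {for x, continuous p}) ->
  (\int[@lebesgue_measure R]_(x in `[a, b]) (p x)%:E = (P b - P a)%:E)%E.
Proof.
move=> ab dP cp.
have cP x : a <= x <= b -> {for x, continuous P} by move=> /dP; exact: is_derive_continuous.
rewrite EFinB; apply: continuous_FTC2 => //.
- apply: continuous_in_subspaceT => x; rewrite inE/= in_itv/=; exact: cp.
- split.
  + move=> x; rewrite in_itv/= => /andP[xa xb].
    by have [] : is_derive x 1 P (p x) by apply: dP; rewrite !ltW.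
  + by apply: cvg_at_right_filter; apply: cP; rewrite lexx ltW.
  + by apply: cvg_at_left_filter; apply: cP; rewrite lexx ltW.
- move=> x; rewrite in_itv/= => /andP[xa xb]; rewrite derive1E.
  by have [_ ->] : is_derive x 1 P (p x) by apply: dP; rewrite !ltW.
Qed.

Lemma integral_itv_cat (R : realType) (w : R -> R) (a b c : R) :
  a <= b -> b <= c -> measurable_fun setT w ->
  (\int[@lebesgue_measure R]_(x in `[a, c]) (w x)%:E =
   \int[@lebesgue_measure R]_(x in `[a, b]) (w x)%:E +
   \int[@lebesgue_measure R]_(x in `[b, c]) (w x)%:E)%E.
Proof.
move=> ab bc /measurable_EFinP mw.
rewrite (itv_bndbnd_setU (x := BRight b)) ?bnd_simp// integral_setU//=.
- by congr (_ + _)%E; rewrite integral_itv_obnd_cbnd//; exact: measurable_funTS.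
- exact: measurable_funTS.
- apply/disj_set2P; apply/seteqP; split=> x //= -[]; rewrite !in_itv/=.
  by move=> /andP[_ xb] /andP[/lt_le_trans /(_ xb)]; rewrite ltxx.
Qed.

(** Carrying the derivative along avoids the operator of derivation, whose value is meaningful only
   together with derivability. *)
Definition C1_pair (R : realType) (P p : R -> R) : Prop :=
  (forall x : R, is_derive x 1 P (p x)) /\ continuous p.

Lemma integral_C1_piece (R : realType) (P p w : R -> R) (a b : R) : a < b ->
  C1_pair P p -> measurable_fun setT w -> (forall x, a < x < b -> w x = p x) ->
  (\int[@lebesgue_measure R]_(x in `[a, b]) (w x)%:E = (P b - P a)%:E)%E.
Proof.
move=> ab [dP cp] mw wp.
rewrite -(integral_derivative (P := P) (p := p))//; last by move=> x _; exact: cp.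
apply: eq_integral_itv_bounded.
- exact: measurable_funTS.
- by apply: measurable_funTS; exact: continuous_measurable_fun.
- by move=> x; rewrite in_itv/=; exact: wp.
Qed.

(** The boundary terms at the two junctions cancel because consecutive primitives agree there, while
   the integrand may jump.  Three pieces are what both uses need: two kinks of the profile in x, two
   kinks of the cutoff in t. *)
Lemma integral_three_pieces0 (R : realType) (P1 P2 P3 p1 p2 p3 w : R -> R)
    (a b c d : R) : a < b -> b < c -> c < d ->
  C1_pair P1 p1 -> C1_pair P2 p2 -> C1_pair P3 p3 -> measurable_fun setT w ->
  (forall x, a < x < b -> w x = p1 x) ->
  (forall x, b < x < c -> w x = p2 x) ->
  (forall x, c < x < d -> w x = p3 x) ->
  (forall x, x < a \/ d < x -> w x = 0) ->
  P1 a = 0 -> P1 b = P2 b -> P2 c = P3 c -> P3 d = 0 ->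
  (\int[@lebesgue_measure R]_x (w x)%:E = 0)%E.
Proof.
move=> ab bc cd C1 C2 C3 mw w1 w2 w3 w0 Pa Pb Pc Pd.
transitivity (\int[@lebesgue_measure R]_(x in `[a, d]) (w x)%:E)%E.
  rewrite [RHS]integral_mkcond; apply: eq_integral => x _.
  rewrite patchE; case: ifPn => //; rewrite notin_setE/= in_itv/= => /negP.
  by rewrite negb_and -!ltNge => /orP h; rewrite w0.
rewrite (integral_itv_cat (a := a) (b := b))// ?(ltW (lt_trans bc cd)) ?ltW//.
rewrite (integral_itv_cat (a := b) (b := c))// ?ltW//.
rewrite (integral_C1_piece (a := a) (P := P1) (p := p1))//.
rewrite (integral_C1_piece (a := b) (P := P2) (p := p2))//.
rewrite (integral_C1_piece (a := c) (P := P3) (p := p3))// Pa Pb Pc Pd -!EFinD.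
by congr EFin; ring.
Qed.

(** Improper integrals are bounded by exhausting the domain by compact intervals and monotone
   convergence, so that a bounded antiderivative is enough. *)
Lemma ge0_integral_antiderivative_le (R : realType) (P p : R -> R) (a b : nat -> R) (B : R) :
  (forall n, a n < b n) ->
  {homo a : n m / (n <= m)%N >-> m <= n} -> {homo b : n m / (n <= m)%N >-> n <= m} ->
  measurable_fun setT p ->
  (forall n x, a n <= x <= b n -> is_derive x 1 P (p x)) ->
  (forall n x, a n <= x <= b n -> {for x, continuous p}) ->
  (forall n x, a n <= x <= b n -> 0 <= p x) ->
  (forall n, P (b n) - P (a n) <= B) ->
  (\int[@lebesgue_measure R]_(x in \bigcup_n `[a n, b n]%classic) (p x)%:E <= B%:E)%E.
Proof.
move=> ab da ib mp dP cp p0 PB.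
have -> : (\int[@lebesgue_measure R]_(x in \bigcup_n `[a n, b n]%classic) (p x)%:E
  = limn (fun n => \int[@lebesgue_measure R]_(x in `[a n, b n]%classic) (p x)%:E))%E.
  apply/esym/cvg_lim => //; apply: ge0_nondecreasing_set_cvg_integral.
  - move=> n m nm; rewrite subsetEset => x /=; rewrite !in_itv/= => /andP[ax xb].
    by rewrite (le_trans _ ax) ?da//= (le_trans xb) ?ib.
  - by move=> n; exact: measurable_itv.
  - by move=> n; apply: measurable_funTS; exact/measurable_EFinP.
  - by move=> n x; rewrite /= in_itv/= lee_fin; exact: p0.
apply: lime_le; last first.
  apply: nearW => n; rewrite (integral_derivative (P := P) (p := p)) ?lee_fin//.
  - by move=> x; exact: cp.
apply: ereal_nondecreasing_is_cvgn.
apply: ge0_nondecreasing_set_nondecreasing_integral.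
- move=> n m nm; rewrite subsetEset => x /=; rewrite !in_itv/= => /andP[ax xb].
  by rewrite (le_trans _ ax) ?da//= (le_trans xb) ?ib.
- by move=> n; exact: measurable_itv.
- by move=> n; apply: measurable_funTS; exact/measurable_EFinP.
- by move=> n x; rewrite /= in_itv/= lee_fin; exact: p0.
Qed.

(** * Test functions *)

Lemma test_function_sub (R : realType) (W V : set (R * R)) (phi : R * R -> R) :
  W `<=` V -> test_function W phi -> test_function V phi.
Proof. by move=> WV [c k s]; split=> // z /s /WV. Qed.

Lemma test_function_Dt_is_derive (R : realType) (W : set (R * R)) (phi : R * R -> R) (x t : R) :
  test_function W phi -> is_derive t 1 (fun t => phi (t, x)) (Dt phi (t, x)).
Proof.
by move=> [/(_ 1%N)[_ [dt _ _ _]] _ _]; apply: DeriveDef; [exact: (dt (t, x))|rewrite /Dt derive1E].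
Qed.

Lemma test_function_Dx_is_derive (R : realType) (W : set (R * R)) (phi : R * R -> R) (x t : R) :
  test_function W phi -> is_derive x 1 (fun x => phi (t, x)) (Dx phi (t, x)).
Proof.
by move=> [/(_ 1%N)[_ [_ dt _ _]] _ _]; apply: DeriveDef; [exact: (dt (t, x))|rewrite /Dx derive1E].
Qed.

Lemma test_function_continuous (R : realType) (W : set (R * R)) (phi : R * R -> R) :
  test_function W phi -> [/\ continuous phi, continuous (Dt phi) & continuous (Dx phi)].
Proof. by move=> [/(_ 1%N)[c [_ _ [ct _] [cx _]]] _ _]; split. Qed.

Lemma test_function0 (R : realType) (phi : R * R -> R) (z : R * R) :
  ~ closure [set z | phi z != 0] z -> [/\ phi z = 0, Dt phi z = 0 & Dx phi z = 0].
Proof.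
case: z => t x; set K := closure _ => nK.
have oK : open (~` K) by apply: closed_openC; exact: closed_closure.
have z0 z : ~ K z -> phi z = 0.
  move=> nKz; apply/eqP; apply: contrapT => /negP pz; apply: nKz.
  exact: subset_closure.
have [/= V [Vt Vx] VK] : nbhs (t, x) (~` K) by exact: open_nbhs_nbhs.
have e0 (f : R -> R) (y : R) : (\forall s \near y, f s = 0) -> derive1 f y = 0.
  move=> h; rewrite derive1E (near_eq_derive (g := cst 0)) ?derive_cst//.
split; [exact: z0| |]; rewrite /Dt /Dx /=; apply: e0.
- near=> s; apply/z0/VK; split => /=; [by near: s|exact: nbhs_singleton].
- near=> s; apply/z0/VK; split => /=; [exact: nbhs_singleton|by near: s].
Unshelve. all: by end_near. Qed.

(** A single constant bounds the support and the sizes, to be used at once for integrability and for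
   restricting the integrals to a compact interval. *)
Lemma test_function_bounds (R : realType) (W : set (R * R)) (phi : R * R -> R) :
  test_function W phi -> exists M : R,
  [/\ forall z : R * R, M < `|z.1| \/ M < `|z.2| -> [/\ phi z = 0, Dt phi z = 0 & Dx phi z = 0],
     forall z, `|phi z| <= M, forall z, `|Dt phi z| <= M & forall z, `|Dx phi z| <= M].
Proof.
move=> tp; have [c1 c2 c3] := test_function_continuous tp; case: tp => _ cK _.
set K := closure _ in cK.
have bnd (f : R * R -> R) : continuous f ->
    exists M : R, 0 <= M /\ forall z : R * R, K z -> `|f z| <= M.
  move=> cf; have /compact_bounded[M [_ hM]] : compact (f @` K).
    by apply: continuous_compact => //; exact: continuous_subspaceT.
  exists (`|M| + 1); split=> [|z Kz]; first by rewrite addr_ge0.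
  apply: (hM (`|M| + 1)); first by rewrite ltr_pwDr// ler_norm.
  by exists z.
have [m1 [p1 h1]] := bnd _ c1; have [m2 [p2 h2]] := bnd _ c2; have [m3 [p3 h3]] := bnd _ c3.
have [m4 [p4 h4]] := bnd fst (fun z => @cvg_fst _ _ (nbhs z.1) (nbhs z.2) _).
have [m5 [p5 h5]] := bnd snd (fun z => @cvg_snd _ _ (nbhs z.1) (nbhs z.2) _).
exists (m1 + m2 + m3 + m4 + m5).
have h0 z : ~ K z -> _ := @test_function0 R phi z.
split => z.
- move=> hz; apply: h0 => Kz; have := h4 _ Kz; have := h5 _ Kz.
  by move: hz => /=; lra.
all: have [Kz|nKz] := pselect (K z);
  [move: (h1 _ Kz) (h2 _ Kz) (h3 _ Kz); lra|
   by case: (h0 _ nKz) => e1 e2 e3; rewrite ?e1 ?e2 ?e3 normr0; lra].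
Qed.

(** * Weak derivatives through lines *)

(** The one-dimensional counterpart of the identity that defines a weak derivative.  It is tested
   against functions of class C^1 since those are what sections of test functions provide. *)
Definition weak_pair (R : realType) (F g : R -> R) : Prop :=
  forall (psi psi' : R -> R) (M : R), C1_pair psi psi' ->
  (forall t, M < `|t| -> psi t = 0 /\ psi' t = 0) ->
  (\int[@lebesgue_measure R]_t (F t * psi' t + g t * psi t)%:E = 0)%E.

Lemma weak_deriv_integral0 (R : realType) (D : (R * R -> R) -> R * R -> R) (U g : R * R -> R) :
  (leb2 R).-integrable setT (EFin \o U) -> (leb2 R).-integrable setT (EFin \o g) ->
  (forall phi, test_function setT phi ->
    continuous (D phi) /\ exists M : R, forall z, `|D phi z| <= M) ->
  (forall phi, test_function setT phi ->
    (leb2 R).-integrable setT (fun z => (U z * D phi z + g z * phi z)%:E) ->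
    (\int[leb2 R]_z (U z * D phi z + g z * phi z)%:E = 0)%E) ->
  weak_deriv D setT U g.
Proof.
move=> iU ig Dphi int0.
have li f : (leb2 R).-integrable setT (EFin \o f) -> loc_integrable setT f.
  move=> intf K cK _; apply: integrableS intf => //; exact: compact_measurable2.
split; [exact: li|exact: li|move=> phi tphi].
have [cD [M DM]] := Dphi _ tphi.
have [N [_ phiN _ _]] := test_function_bounds tphi.
have [cphi _ _] := test_function_continuous tphi.
have bdd (f : R * R -> R) (B : R) : (forall z, `|f z| <= B) -> [bounded f z | z in setT].
  by move=> fB; exists B; split; [exact: num_real|move=> x Bx z _; exact: le_trans (fB z) (ltW Bx)].
have i1 : (leb2 R).-integrable setT (EFin \o (fun z => U z * D phi z)).
  have -> : EFin \o (fun z => U z * D phi z) = ((EFin \o U) \* (EFin \o D phi))%E by [].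
  apply: integrableMl => //; first exact: continuous_measurable2.
  exact: bdd DM.
have i2 : (leb2 R).-integrable setT (EFin \o (fun z => g z * phi z)).
  have -> : EFin \o (fun z => g z * phi z) = ((EFin \o g) \* (EFin \o phi))%E by [].
  apply: integrableMl => //; first exact: continuous_measurable2.
  exact: bdd phiN.
apply/eqP; rewrite -subr_eq0 opprK -RintegralD//; apply/eqP.
rewrite /Rintegral int0//.
have := integrableD measurableT i1 i2.
by apply: eq_integrable.
Qed.

(** The lines [x != 0] suffice since the remaining one is negligible; the solution is singular on
   the line x = 0. *)
Lemma weak_deriv_t (R : realType) (U g : R * R -> R) :
  (leb2 R).-integrable setT (EFin \o U) -> (leb2 R).-integrable setT (EFin \o g) ->
  (forall x, x != 0 -> weak_pair (fun t => U (t, x)) (fun t => g (t, x))) ->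
  weak_deriv (@Dt R) setT U g.
Proof.
move=> iU ig wp; apply: weak_deriv_integral0 => // phi tphi.
  have [_ c _] := test_function_continuous tphi.
  by have [M [_ _ h _]] := test_function_bounds tphi; split=> //; exists M.
move=> iw; rewrite -integral21_prod_meas1//.
have [_ ct _] := test_function_continuous tphi.
have [M [phi0 _ _ _]] := test_function_bounds tphi.
rewrite (ae_eq_integral (cst 0)) ?integral0//; first exact: (measurable_fubini_G iw).
  exists [set 0]; split => //; first exact: lebesgue_measure_set1.
  move=> x /= hx; apply: contrapT => /eqP x0; apply: hx => _.
  rewrite /fubini_G /=; apply: (wp x x0 (fun t => phi (t, x)) (fun t => Dt phi (t, x)) M).
    split=> [t|]; first exact: test_function_Dt_is_derive tphi.
    by move=> t; apply: (@continuous_comp _ _ _ (fun t => (t, x)) (Dt phi));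
      [exact: cvg_pair cvg_id (cvg_cst _)|exact: ct].
  by move=> t Mt; have [-> -> _] := phi0 (t, x) (or_introl Mt).
Qed.

Lemma weak_deriv_x (R : realType) (U g : R * R -> R) :
  (leb2 R).-integrable setT (EFin \o U) -> (leb2 R).-integrable setT (EFin \o g) ->
  (forall t, t != 0 -> weak_pair (fun x => U (t, x)) (fun x => g (t, x))) ->
  weak_deriv (@Dx R) setT U g.
Proof.
move=> iU ig wp; apply: weak_deriv_integral0 => // phi tphi.
  have [_ _ c] := test_function_continuous tphi.
  by have [M [_ _ _ h]] := test_function_bounds tphi; split=> //; exists M.
move=> iw; rewrite -integral12_prod_meas1//.
have [_ _ cx] := test_function_continuous tphi.
have [M [phi0 _ _ _]] := test_function_bounds tphi.
rewrite (ae_eq_integral (cst 0)) ?integral0//; first exact: (measurable_fubini_F iw).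
  exists [set 0]; split => //; first exact: lebesgue_measure_set1.
  move=> t /= ht; apply: contrapT => /eqP t0; apply: ht => _.
  rewrite /fubini_F /=; apply: (wp t t0 (fun x => phi (t, x)) (fun x => Dx phi (t, x)) M).
    split=> [x|]; first exact: test_function_Dx_is_derive tphi.
    by move=> x; apply: (@continuous_comp _ _ _ (fun x => (t, x)) (Dx phi));
      [exact: cvg_pair (cvg_cst _) cvg_id|exact: cx].
  by move=> x Mx; have [-> _ ->] := phi0 (t, x) (or_intror Mx).
Qed.

(** A test function of the strip is one of the plane, and it vanishes together with its derivatives
   outside the strip. *)
Lemma weak_deriv_Q (R : realType) (D : (R * R -> R) -> R * R -> R) (U g : R * R -> R) :
  (forall (phi : R * R -> R) (z : R * R), ~ closure [set z | phi z != 0] z -> D phi z = 0) ->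
  weak_deriv D setT U g -> weak_deriv D (Q R) U g.
Proof.
move=> D0 [lU lg wU]; split.
- by move=> K cK _; exact: lU.
- by move=> K cK _; exact: lg.
move=> phi tphi.
have QT (f : R * R -> R) : (forall z, ~ Q R z -> f z = 0) ->
    \int[leb2 R]_(z in Q R) f z = \int[leb2 R]_z f z.
  move=> f0; rewrite Rintegral_mkcond; apply: eq_Rintegral => z _.
  by rewrite patchE; case: ifPn => //; rewrite notin_setE => /f0.
have [_ _ sQ] := tphi.
rewrite !QT; first exact/wU/(test_function_sub _ tphi).
- by move=> z nQ; have [-> _ _] := @test_function0 R phi z (fun K => nQ (sQ _ K)); rewrite mulr0.
- by move=> z nQ; rewrite D0 ?mulr0// => K; exact: nQ (sQ _ K).
Qed.

Lemma C1_pair_mul (R : realType) (P p S s : R -> R) :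
  C1_pair P p -> C1_pair S s -> C1_pair (fun x => P x * S x) (fun x => P x * s x + p x * S x).
Proof.
move=> [dP cp] [dS cs].
split=> [x|x].
  apply: (is_derive_eq (is_deriveM (dP x) (dS x))).
  by rewrite /GRing.scale/= [S x * _]mulrC.
have cP := is_derive_continuous (dP x); have cS := is_derive_continuous (dS x).
by apply: cvgD; apply: cvgM; [exact: cP|exact: cs|exact: cp|exact: cS].
Qed.

Lemma C1_pair_continuous (R : realType) (P p : R -> R) : C1_pair P p -> continuous P.
Proof.
by move=> [dP cp] x; exact: is_derive_continuous (dP x).
Qed.

(** The product with a test function is again made of three pieces of class C^1, and it vanishes far
   away. *)
Lemma weak_pair_pieces (R : realType) (F g F1 g1 F2 g2 F3 g3 : R -> R) (b c : R) : b < c ->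
  C1_pair F1 g1 -> C1_pair F2 g2 -> C1_pair F3 g3 ->
  measurable_fun setT F -> measurable_fun setT g ->
  (forall x, x <= b -> F x = F1 x) ->
  (forall x, b <= x <= c -> F x = F2 x) ->
  (forall x, c <= x -> F x = F3 x) ->
  (forall x, x < b -> g x = g1 x) ->
  (forall x, b < x < c -> g x = g2 x) ->
  (forall x, c < x -> g x = g3 x) ->
  weak_pair F g.
Proof.
move=> bc C1 C2 C3 mF mg F1E F2E F3E g1E g2E g3E psi psi' M Cpsi psi0.
have psiM : measurable_fun setT psi.
  by apply: continuous_measurable_fun; exact: C1_pair_continuous Cpsi.
have psi'M : measurable_fun setT psi'.
  by apply: continuous_measurable_fun; case: Cpsi.
(* Far enough for the test function to vanish outside [a, d], and beyond both junctions. *)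
pose a := - (`|M| + `|b| + 1); pose d := `|M| + `|c| + 1.
have M1 := ler_norm M; have M2 := normr_ge0 M.
have b1 := ler_norm (- b); have b2 := normr_ge0 b; rewrite normrN in b1.
have c1 := ler_norm c; have c2 := normr_ge0 c.
have ab : a < b by rewrite /a; lra.
have cd : c < d by rewrite /d; lra.
have psia (x : R) : x <= a -> psi x = 0 /\ psi' x = 0.
  move=> xa; apply: psi0; rewrite ler0_norm; move: xa; rewrite /a; lra.
have psid (x : R) : d <= x -> psi x = 0 /\ psi' x = 0.
  move=> dx; apply: psi0; rewrite ger0_norm; move: dx; rewrite /d; lra.
apply: (integral_three_pieces0 ab bc cd
  (C1_pair_mul C1 Cpsi) (C1_pair_mul C2 Cpsi) (C1_pair_mul C3 Cpsi)).
- by apply: measurable_funD; exact: measurable_funM.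
- by move=> x /andP[_ xb]; rewrite F1E ?g1E// ltW.
- by move=> x /andP[bx xc]; rewrite F2E ?g2E ?bx// !ltW.
- by move=> x /andP[cx _]; rewrite F3E ?g3E// ltW.
- by move=> x [/ltW/psia|/ltW/psid] [-> ->]; rewrite !mulr0 addr0.
- by rewrite (psia a (lexx a)).1 mulr0.
- by rewrite -F1E// -F2E// lexx ltW.
- by rewrite -F3E// -F2E// lexx ltW.
- by rewrite (psid d (lexx d)).1 mulr0.
Qed.

Lemma weak_pair_C1 (R : realType) (F g : R -> R) : C1_pair F g -> weak_pair F g.
Proof.
move=> C; have mF := continuous_measurable_fun (C1_pair_continuous C).
have mg : measurable_fun setT g by case: C => _ /continuous_measurable_fun.
exact: (weak_pair_pieces (ltr01 : 0 < 1 :> R) C C C).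
Qed.

(** * Integrability of self-similar functions *)

Lemma continuous_cauchy (R : realType) (m : R) :
  continuous (fun x : R => (1 + (m * x) ^+ 2)^-1).
Proof.
move=> x; apply: cvgV; first by rewrite gt_eqF// ltr_pwDl// sqr_ge0.
apply: cvgD; first exact: cvg_cst.
by apply: cvgM; apply: cvgM => //; exact: cvg_cst.
Qed.

Lemma integral_cauchy_le (R : realType) (m : R) : 0 < m ->
  (\int[@lebesgue_measure R]_x ((1 + (m * x) ^+ 2)^-1)%:E <= (pi / m)%:E)%E.
Proof.
move=> m0; pose p (x : R) := (1 + (m * x) ^+ 2)^-1.
have den0 (x : R) : 1 + (m * x) ^+ 2 != 0 by rewrite gt_eqF// ltr_pwDl// sqr_ge0.
have cp : continuous p by exact: continuous_cauchy.
have UT : \bigcup_n `[- n.+1%:R, n.+1%:R]%classic = [set: R].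
  apply/seteqP; split => // x _; exists (Num.trunc `|x|) => //=.
  rewrite in_itv/= -ler_norml; apply/ltW.
  by have /andP[] := truncn_itv (normr_ge0 x).
rewrite -UT; apply: (ge0_integral_antiderivative_le (P := fun x => atan (m * x) / m)).
- by move=> n; rewrite (@lt_trans _ _ 0)// oppr_lt0.
- by move=> n k nk; rewrite lerN2 ler_nat.
- by move=> n k nk; rewrite ler_nat.
- exact: continuous_measurable_fun.
- move=> n x _; have dm : is_derive x 1 (fun y : R => m * y) m.
    by apply: (is_derive_eq (is_deriveZ _ _)); rewrite /GRing.scale/= mulr1.
  have da := is_derive1_comp (is_derive1_atan (m * x)) dm.
  have := is_deriveM da (is_derive_cst m^-1 x 1).
  move=> h; apply: (is_derive_eq h); rewrite /GRing.scale/= mulr0 add0r.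
  by rewrite /p; field; rewrite den0 gt_eqF.
- by move=> n x _; exact: cp.
- by move=> n x _; rewrite invr_ge0 addr_ge0// sqr_ge0.
- move=> n; rewrite -mulrBl ler_pM2r ?invr_gt0//.
  have := atan_ltpi2 (m * n.+1%:R); have := atan_gtNpi2 (m * - n.+1%:R); lra.
Qed.

Lemma integral_powR_lty (R : realType) (r K : R) : 0 < r -> 0 <= K ->
  (\int[@lebesgue_measure R]_(t in `]0%R, 2%R]) (K * t `^ (r - 1))%:E < +oo)%E.
Proof.
move=> r0 K0; have UT : \bigcup_n `[n.+1%:R^-1, 2]%classic = `]0, 2]%classic :> set R.
  apply/seteqP; split => [x [n _ /=]|x /=]; rewrite !in_itv/= => /andP[x0 x2].
    by rewrite x2 andbT (lt_le_trans _ x0)// invr_gt0.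
  exists (Num.trunc x^-1) => //=; rewrite in_itv/= x2 andbT.
  rewrite -[leRHS]invrK lef_pV2 ?posrE ?invr_gt0//; apply/ltW.
  have xi : 0 <= x^-1 by rewrite invr_ge0 ltW.
  by have /andP[] := truncn_itv xi.
rewrite -UT; apply: (@le_lt_trans _ _ (K * 2 `^ r / r)%:E); last exact: ltry.
have pos n (x : R) : n.+1%:R^-1 <= x <= 2 -> 0 < x.
  by move=> /andP[x0 _]; rewrite (lt_le_trans _ x0)// invr_gt0.
apply: (ge0_integral_antiderivative_le (P := fun x => K * x `^ r / r)).
- by move=> n; rewrite (@le_lt_trans _ _ 1)// ?ltr1n// invf_le1// ler1n.
- by move=> n k nk; rewrite lef_pV2 ?posrE// ler_nat.
- by [].
- by apply: measurable_funM => //; exact: measurable_powR.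
- move=> n x /pos x0; have h := is_derive1_powR r x0.
  have h2 := is_deriveM (is_derive_cst K x 1) h.
  have h3 := is_deriveM h2 (is_derive_cst r^-1 x 1).
  apply: (is_derive_eq h3); rewrite /GRing.scale/= !mulr0 add0r addr0.
  by field; rewrite gt_eqF.
- move=> n x /pos x0; apply: cvgM; first exact: cvg_cst.
  exact: is_derive_continuous (is_derive1_powR (r - 1) x0).
- by move=> n x _; rewrite mulr_ge0// powR_ge0.
- by move=> n; rewrite gerBl divr_ge0// ?mulr_ge0 ?powR_ge0// ltW.
Qed.

(** The size of t^(-B) k (xi) for a profile k that decays at least like 1 / (1 + xi^2). *)
Definition dominated (R : realType) (lam B : R) (w : R * R -> R) : Prop :=
  exists C : R, forall t x, 0 < t < 2 ->
    `|w (t, x)| <= C * t `^ (- B) / (1 + (lam * t `^ (- 2^-1) * x) ^+ 2).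

(** For fixed t the bound is a Cauchy density in x of width sqrt t / lam, so that its integral in x
   is of order t^(- b q + 1/2), and this is integrable near t = 0 exactly when b q < 3/2.  The power
   q of the Cauchy factor is discarded, since this factor is at most 1. *)
Lemma dominated_Lfun (R : realType) (lam b q : R) (w : R * R -> R) :
  0 < lam -> 1 <= q -> b * q < 3 / 2 -> measurable_fun setT w -> dominated lam b w ->
  (forall t x, ~~ (0 < t < 2) -> w (t, x) = 0) ->
  w \in Lfun (leb2 R) q%:E.
Proof.
move=> l0 q1 bq mw [C wb] w0.
have q0 : 0 < q by apply: lt_le_trans q1.
have C0 : 0 <= C.
  have /le_trans : 0 <= `|w (1, 0)| by [].
  move=> /(_ _ (wb 1 0 _)); rewrite powR1 mulr0 expr0n/= addr0 divr1 mulr1; apply.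
  by rewrite ltr01 ltr1n.
rewrite inE/=; apply/andP; split; rewrite inE//= /finite_norm unlock.
apply: poweR_lty.
pose W (z : R * R) := `|w z| `^ q.
rewrite -[X in (X < _)%E]/(\int[(@lebesgue_measure R \x @lebesgue_measure R)%E]_z (EFin \o W) z)%E.
have mW : measurable_fun setT W.
  apply: (measurableT_comp (@measurable_powR R q)).
  exact: measurableT_comp.
have mWE : measurable_fun setT (EFin \o W) by exact/measurable_EFinP.
rewrite fubini_tonelli1//; last by move=> z; rewrite lee_fin powR_ge0.
pose r := 3 / 2 - b * q; pose K := C `^ q * (pi / lam).
have r0 : 0 < r by rewrite /r subr_gt0.
have K0 : 0 <= K by rewrite mulr_ge0 ?powR_ge0// divr_ge0 ?pi_ge0// ltW.
apply: le_lt_trans (integral_powR_lty r0 K0).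
have Wt0 t : ~~ (0 < t < 2) -> fubini_F (@lebesgue_measure R) (EFin \o W) t = 0%E.
  move=> t02; rewrite /fubini_F integral0_eq// => x _.
  by rewrite /= /W w0// normr0 powR0// gt_eqF.
have F0 t : (0 <= fubini_F (@lebesgue_measure R) (EFin \o W) t)%E.
  by apply: integral_ge0 => x _; rewrite lee_fin powR_ge0.
have -> : (\int[@lebesgue_measure R]_t fubini_F (@lebesgue_measure R) (EFin \o W) t =
  \int[@lebesgue_measure R]_(t in `]0%R, 2%R]) fubini_F (@lebesgue_measure R) (EFin \o W) t)%E.
  rewrite [RHS]integral_mkcond; apply: eq_integral => t _.
  rewrite patchE; case: ifPn => //; rewrite notin_setE/= in_itv/= => /negP t02.
  by apply: Wt0; apply: contra t02 => /andP[-> /ltW].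
have mK : measurable_fun setT (fun t => K * t `^ (r - 1)).
  by apply: measurable_funM => //; exact: measurable_powR.
apply: ge0_le_integral => //.
- by apply: measurable_funTS; apply: measurable_fun_fubini_tonelli_F => // z;
     rewrite lee_fin powR_ge0.
- apply/measurable_EFinP; exact: measurable_funTS.
move=> t /=; rewrite in_itv/= => /andP[t0 t2].
have [t02|/Wt0 ->] := boolP (0 < t < 2); last by rewrite lee_fin mulr_ge0// powR_ge0.
set s := lam * t `^ (- 2^-1).
have s0 : 0 < s by rewrite mulr_gt0// powR_gt0.
pose A := C `^ q * t `^ (- b * q).
have A0 : 0 <= A by rewrite mulr_ge0// powR_ge0.
have inn x : W (t, x) <= A * (1 + (s * x) ^+ 2)^-1.
  have den : 1 <= 1 + (s * x) ^+ 2 by rewrite lerDl sqr_ge0.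
  have den0 : 0 < 1 + (s * x) ^+ 2 by rewrite (lt_le_trans _ den).
  apply: (@le_trans _ _ ((C * t `^ (- b) / (1 + (s * x) ^+ 2)) `^ q)).
    apply: ge0_ler_powR; rewrite ?nnegrE ?(ltW q0)//; last exact: wb.
    by rewrite divr_ge0 ?(ltW den0)// mulr_ge0// powR_ge0.
  rewrite powRM ?invr_ge0 ?(ltW den0)//; last by rewrite mulr_ge0// powR_ge0.
  rewrite powRM ?powR_ge0// -powRrM ler_wpM2l//.
  by apply: ge1r_powR => //; rewrite invr_gt0 den0 invf_le1.
have mc := continuous_measurable_fun (@continuous_cauchy R s).
rewrite /fubini_F; apply: (@le_trans _ _
  (\int[@lebesgue_measure R]_x (A%:E * ((1 + (s * x) ^+ 2)^-1)%:E))%E).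
  apply: ge0_le_integral => //.
  - by move=> x _; rewrite lee_fin powR_ge0.
  - exact: (measurableT_comp mWE (pair1_measurable t)).
  - by apply/measurable_EFinP; exact: measurable_funM.
  - by move=> x _; rewrite lee_fin inn.
rewrite ge0_integralZl//; last 2 first.
- exact/measurable_EFinP.
- by move=> x _; rewrite lee_fin invr_ge0 addr_ge0// sqr_ge0.
apply: (@le_trans _ _ (A%:E * (pi / s)%:E)%E).
  by rewrite lee_wpmul2l ?lee_fin// integral_cauchy_le.
rewrite -EFinM lee_fin /A /K /s.
have -> : t `^ (r - 1) = t `^ (- b * q) / t `^ (- 2^-1).
  rewrite -powRB; last by rewrite (gt_eqF t0) implybT.
  by congr (_ `^ _); rewrite /r; field.
rewrite le_eqVlt; apply/orP; left; apply/eqP.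
by field; rewrite !gt_eqF ?powR_gt0.
Qed.

(** * Three-piece functions and pointwise rules of derivation *)

Lemma is_derive_glue (R : realType) (f1 f2 : R -> R) (a d : R) :
  is_derive a 1 f1 d -> is_derive a 1 f2 d -> f1 a = f2 a ->
  is_derive a 1 (fun x => if x <= a then f1 x else f2 x) d.
Proof.
move=> [d1 e1] [d2 e2] fa.
set f := fun x => _.
have cv : h^-1 *: ((f \o shift a) (h *: (1:R)) - f a) @[h --> 0^'] --> d.
  apply: (@cvg_at_right_left_dnbhs _ R^o).
  - have : h^-1 *: ((f2 \o shift a) (h *: (1:R)) - f2 a) @[h --> 0^'+] --> d.
      by apply: cvg_dnbhs_at_right; rewrite -e2; exact: d2.
    apply: cvg_trans; apply: near_eq_cvg; near=> h.
    have h0 : 0 < h by near: h; exact: nbhs_right_gt.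
    by rewrite /f /= lexx -fa ifF// scaler1; apply/negbTE; rewrite -ltNge ltrDr.
  - have : h^-1 *: ((f1 \o shift a) (h *: (1:R)) - f1 a) @[h --> 0^'-] --> d.
      by apply: cvg_dnbhs_at_left; rewrite -e1; exact: d1.
    apply: cvg_trans; apply: near_eq_cvg; near=> h.
    have h0 : h < 0 by near: h; exact: nbhs_left_lt.
    by rewrite /f /= lexx ifT// scaler1 gerDr ltW.
by apply: DeriveDef; [apply/cvg_ex; exists d|exact/cvg_lim].
Unshelve. all: by end_near. Qed.

(** The glued function is f1 (min x a) + f2 (max x a) - f1 a. *)
Lemma continuous_glue (R : realType) (f1 f2 : R -> R) (a : R) :
  continuous f1 -> continuous f2 -> f1 a = f2 a ->
  continuous (fun x => if x <= a then f1 x else f2 x).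
Proof.
move=> c1 c2 fa.
have -> : (fun x => if x <= a then f1 x else f2 x) =
    (fun x => f1 (Num.min x a) + f2 (Num.max x a) - f1 a).
  apply/funext => x; have [xa|ax] := leP x a; first by rewrite -fa addrK.
  by rewrite addrAC subrr add0r.
move=> x; have cid : continuous (id : R -> R) by move=> ?; exact: cvg_id.
have ca : continuous (cst a : R -> R) by move=> ?; exact: cvg_cst.
apply: cvgB; last exact: cvg_cst.
apply: cvgD.
- apply: (@continuous_comp _ _ _ (fun x => Num.min x a) f1); last exact: c1.
  exact: (continuous_min (cid x) (ca x)).
- apply: (@continuous_comp _ _ _ (fun x => Num.max x a) f2); last exact: c2.
  exact: (continuous_max (cid x) (ca x)).
Qed.

Definition three_pieces (R : realType) (f g k : R -> R) (x : R) : R :=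
  if x <= -1 then f x else if x <= 1 then g x else k x.

Lemma continuous_three_pieces (R : realType) (f g k : R -> R) :
  continuous f -> continuous g -> continuous k -> f (-1) = g (-1) -> g 1 = k 1 ->
  continuous (three_pieces f g k).
Proof.
move=> cf cg ck fg gk; apply: continuous_glue => //; first exact: continuous_glue.
by rewrite ifT//; lra.
Qed.

Lemma measurable_three_pieces (R : realType) (f g k : R -> R) :
  measurable_fun setT f -> measurable_fun setT g -> measurable_fun setT k ->
  measurable_fun setT (three_pieces f g k).
Proof.
move=> mf mg mk; apply: measurable_fun_ifT => //; first exact: measurable_fun_ler.
by apply: measurable_fun_ifT => //; exact: measurable_fun_ler.
Qed.

Lemma is_derive_three_pieces (R : realType) (f g k f' g' k' : R -> R) (x : R) :
  (forall x : R, is_derive x 1 f (f' x)) -> (forall x : R, is_derive x 1 g (g' x)) ->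
  (forall x : R, is_derive x 1 k (k' x)) ->
  f (-1) = g (-1) -> g 1 = k 1 -> f' (-1) = g' (-1) -> g' 1 = k' 1 ->
  is_derive x 1 (three_pieces f g k) (three_pieces f' g' k' x).
Proof.
move=> df dg dk fg gk fg' gk'.
have glue (u v u' v' : R -> R) (a : R) : (forall x : R, is_derive x 1 u (u' x)) ->
    (forall x : R, is_derive x 1 v (v' x)) -> u a = v a -> u' a = v' a ->
    forall x : R, is_derive x 1 (fun x => if x <= a then u x else v x)
                      (if x <= a then u' x else v' x).
  move=> du dv uv uv' y; have [ya|ay|->] := ltgtP y a.
  - apply: (near_eq_is_derive (f := u)) => //; near=> z.
    by rewrite ifT// ltW//; near: z; exact: lt_nbhsl.
  - apply: (near_eq_is_derive (f := v)) => //; near=> z.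
    by rewrite ifF//; apply/negbTE; rewrite -ltNge; near: z; exact: lt_nbhsr.
  - by apply: is_derive_glue => //; rewrite uv'.
apply: (glue f (fun x => if x <= 1 then g x else k x)
           f' (fun x => if x <= 1 then g' x else k' x)) => //.
- exact: glue.
- by rewrite ifT//; lra.
- by rewrite ifT//; lra.
Unshelve. all: by end_near. Qed.

(** The rules of derivation for functions written pointwise, so that the derivative of an explicit
   formula can be assembled as a term. *)
Section Derive_pointwise.
Variable R : realType.
Implicit Types (f g : R -> R) (x a b : R).

Lemma fderiv_cst x a : is_derive x 1 (fun _ : R => a) 0.
Proof. exact: is_derive_cst. Qed.

Lemma fderiv_id x : is_derive x 1 (fun y : R => y) 1.
Proof. exact: is_derive_id. Qed.

Lemma fderiv_add f g x a b : is_derive x 1 f a -> is_derive x 1 g b ->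
  is_derive x 1 (fun y => f y + g y) (a + b).
Proof. by move=> df dg; exact: (is_deriveD df dg). Qed.

Lemma fderiv_opp f x a : is_derive x 1 f a -> is_derive x 1 (fun y => - f y) (- a).
Proof. by move=> df; exact: (is_deriveN df). Qed.

Lemma fderiv_mul f g x a b : is_derive x 1 f a -> is_derive x 1 g b ->
  is_derive x 1 (fun y => f y * g y) (f x * b + a * g x).
Proof.
move=> df dg; apply: (is_derive_eq (is_deriveM df dg)).
by rewrite /GRing.scale/= [g x * _]mulrC.
Qed.

Lemma fderiv_inv f x a : f x != 0 -> is_derive x 1 f a ->
  is_derive x 1 (fun y => (f y)^-1) (- a / f x ^+ 2).
Proof.
move=> f0 df; apply: (is_derive_eq (is_deriveV f0 df)).
by rewrite /GRing.scale/= mulNr mulrC mulNr.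
Qed.

Lemma fderiv_comp f g x a b : is_derive (g x) 1 f a -> is_derive x 1 g b ->
  is_derive x 1 (fun y => f (g y)) (a * b).
Proof. by move=> df dg; exact: (is_derive1_comp df dg). Qed.

Lemma fderiv_expR f x a : is_derive x 1 f a ->
  is_derive x 1 (fun y => expR (f y)) (expR (f x) * a).
Proof. by move=> df; apply: fderiv_comp df; exact: is_derive_expR. Qed.

Lemma fderiv_sqr f x a : is_derive x 1 f a -> is_derive x 1 (fun y => f y ^+ 2) (2 * f x * a).
Proof.
move=> df; apply: (is_derive_eq (fderiv_mul df df)); ring.
Qed.
End Derive_pointwise.

(** * The profile *)

(** This constant makes [xi * phi_in] reach h/2 exactly where phi^2 = phi'/2. *)
Definition kappa (R : realType) (h : R) : R := (1 - h) / h.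

(** Here and below phi stands for minus one half of the logarithmic derivative of the profile. *)
Definition phi_in (R : realType) (h x : R) : R := x / (1 + kappa h * x ^+ 2).
Definition dphi_in (R : realType) (h x : R) : R :=
  (1 - kappa h * x ^+ 2) / (1 + kappa h * x ^+ 2) ^+ 2.
Definition profile_in (R : realType) (h x : R) : R :=
  expR (- ((kappa h)^-1 * ln (1 + kappa h * x ^+ 2))).

(** The sign s is 1 on the right of 1 and -1 on the left of -1. *)
Definition phi_out (R : realType) (h s x : R) : R := h ^+ 2 * x + s * (h * (1 - h)).
(** The normalization that makes the outer profile agree with the inner one at 1 and -1. *)
Definition shift_out (R : realType) (h : R) : R :=
  (kappa h)^-1 * ln (1 + kappa h) - h ^+ 2 - 2 * (h * (1 - h)).
Definition profile_out (R : realType) (h s x : R) : R :=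
  expR (- (h ^+ 2 * x ^+ 2 + s * (2 * (h * (1 - h))) * x + shift_out h)).

Lemma kappa_gt0 (R : realType) (h : R) : 0 < h < 1 -> 0 < kappa h.
Proof. by move=> /andP[h0 h1]; rewrite /kappa divr_gt0// subr_gt0. Qed.

Lemma kappa_den_gt0 (R : realType) (h x : R) : 0 < h < 1 -> 0 < 1 + kappa h * x ^+ 2.
Proof. by move=> h01; rewrite ltr_pwDl// mulr_ge0 ?sqr_ge0// ltW// kappa_gt0. Qed.

Definition profile (R : realType) (h : R) : R -> R :=
  three_pieces (profile_out h (-1)) (profile_in h) (profile_out h 1).
Definition dprofile (R : realType) (h : R) : R -> R := three_pieces
  (fun x => - 2 * phi_out h (-1) x * profile_out h (-1) x)
  (fun x => - 2 * phi_in h x * profile_in h x)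
  (fun x => - 2 * phi_out h 1 x * profile_out h 1 x).
Definition d2profile (R : realType) (h : R) : R -> R := three_pieces
  (fun x => (4 * phi_out h (-1) x ^+ 2 - 2 * h ^+ 2) * profile_out h (-1) x)
  (fun x => (4 * phi_in h x ^+ 2 - 2 * dphi_in h x) * profile_in h x)
  (fun x => (4 * phi_out h 1 x ^+ 2 - 2 * h ^+ 2) * profile_out h 1 x).
(** In terms of X = s x and z = 1 + h (X - 1) one has phi = s h z, and this is the quotient
   (2 X z - 1) / (h^2 (2 z^2 - 1)) of the two sides of the equation for the profile. *)
Definition coef_out (R : realType) (h s x : R) : R :=
  (2 * (s * x) * (1 + h * (s * x - 1)) - 1) /
  (h ^+ 2 * (2 * (1 + h * (s * x - 1)) ^+ 2 - 1)).
Definition coef (R : realType) (h : R) : R -> R := three_pieces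
  (coef_out h (-1)) (fun x => 1 + kappa h * x ^+ 2) (coef_out h 1).

Section Profile.
Variables (R : realType) (h : R).
Hypothesis h01 : 0 < h < 1.
Let h0 : 0 < h. Proof. by case/andP: h01. Qed.
Let hsq : h ^+ 2 <= 1. Proof. by case/andP: h01 => _ h1; rewrite exprn_ile1 ?(ltW h0) ?ltW. Qed.
Let k0 : kappa h != 0. Proof. by rewrite gt_eqF// kappa_gt0. Qed.
Let den0 x : 1 + kappa h * x ^+ 2 != 0. Proof. by rewrite gt_eqF// kappa_den_gt0. Qed.

Let is_derive_den (x : R) : is_derive x 1 (fun y => 1 + kappa h * y ^+ 2) (2 * kappa h * x).
Proof.
apply: (is_derive_eq (fderiv_add (fderiv_cst x 1)
  (fderiv_mul (fderiv_cst x (kappa h)) (fderiv_sqr (fderiv_id x))))); ring.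
Qed.

Lemma is_derive_profile_in (x : R) :
  is_derive x 1 (profile_in h) (- 2 * phi_in h x * profile_in h x).
Proof.
have d2 := @fderiv_comp R (@ln R) (fun y => 1 + kappa h * y ^+ 2) _ _ _
  (is_derive1_ln (kappa_den_gt0 x h01)) (is_derive_den x).
apply: (is_derive_eq (fderiv_expR (fderiv_opp (fderiv_mul (fderiv_cst x (kappa h)^-1) d2)))).
rewrite -/(profile_in h x) /phi_in; field; exact/andP.
Qed.

Lemma is_derive_phi_in (x : R) : is_derive x 1 (phi_in h) (dphi_in h x).
Proof.
apply: (is_derive_eq (fderiv_mul (fderiv_id x)
  (@fderiv_inv R (fun y => 1 + kappa h * y ^+ 2) _ _ (den0 x) (is_derive_den x)))).
by rewrite /dphi_in; field.
Qed.

Lemma is_derive_phi_out (s x : R) : is_derive x 1 (phi_out h s) (h ^+ 2).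
Proof.
apply: (is_derive_eq (fderiv_add
  (fderiv_mul (fderiv_cst x (h ^+ 2)) (fderiv_id x)) (fderiv_cst x _))).
by ring.
Qed.

Lemma is_derive_profile_out (s x : R) :
  is_derive x 1 (profile_out h s) (- 2 * phi_out h s x * profile_out h s x).
Proof.
have d := fderiv_add (fderiv_mul (fderiv_cst x (h ^+ 2)) (fderiv_sqr (fderiv_id x)))
            (fderiv_mul (fderiv_cst x (s * (2 * (h * (1 - h))))) (fderiv_id x)).
apply: (is_derive_eq (fderiv_expR (fderiv_opp (fderiv_add d (fderiv_cst x (shift_out h)))))).
by rewrite -/(profile_out h s x) /phi_out; ring.
Qed.

Lemma continuous_dphi_in : continuous (dphi_in h).
Proof.
move=> x; apply: cvgM.
  by apply: cvgB; [exact: cvg_cst|apply: cvgM; [exact: cvg_cst|apply: cvgM]].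
apply: cvgV; first by rewrite expf_neq0.
have c : (1 + kappa h * y ^+ 2) @[y --> x] --> 1 + kappa h * x ^+ 2.
  exact: is_derive_continuous (is_derive_den x).
exact: (cvgM c c).
Qed.

Lemma C1_pair_log_derivative (f phi dphi : R -> R) :
  (forall x : R, is_derive x 1 f (- 2 * phi x * f x)) ->
  (forall x : R, is_derive x 1 phi (dphi x)) -> continuous dphi ->
  C1_pair f (fun x => - 2 * phi x * f x) /\
  C1_pair (fun x => - 2 * phi x * f x) (fun x => (4 * phi x ^+ 2 - 2 * dphi x) * f x).
Proof.
move=> df dphiE cdphi.
have cf x := is_derive_continuous (df x); have cp x := is_derive_continuous (dphiE x).
split; split.
- exact: df.
- by move=> x; apply: cvgM; [apply: cvgM; [exact: cvg_cst|exact: cp]|exact: cf].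
- move=> x; apply: (is_derive_eq (fderiv_mul (fderiv_mul (fderiv_cst x (- 2)) (dphiE x)) (df x))).
  by ring.
- move=> x; apply: cvgM; last exact: cf.
  apply: cvgB; apply: cvgM; [exact: cvg_cst| |exact: cvg_cst|exact: cdphi].
  by apply: cvgM; exact: cp.
Qed.

Definition C1_profile_in :=
  C1_pair_log_derivative is_derive_profile_in is_derive_phi_in continuous_dphi_in.
Definition C1_profile_out s :=
  C1_pair_log_derivative (is_derive_profile_out s) (is_derive_phi_out s) (fun x => cvg_cst _).

Lemma phi_in_out (s : R) : s ^+ 2 = 1 -> phi_in h s = phi_out h s s.
Proof.
move=> s1; rewrite /phi_in /phi_out s1 /kappa; field.
by rewrite gt_eqF//= ; apply/eqP; lra.
Qed.

Lemma profile_in_out (s : R) : s ^+ 2 = 1 -> profile_in h s = profile_out h s s.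
Proof.
move=> s1; rewrite /profile_in /profile_out /shift_out s1; congr expR.
rewrite mulr1 (_ : s * _ * s = 2 * (h * (1 - h))); first ring.
by rewrite mulrAC -expr2 s1 mul1r.
Qed.


Lemma C1_profile : C1_pair (profile h) (dprofile h).
Proof.
have [[di ci] _] := C1_profile_in; have [[dl cl] _] := C1_profile_out (-1).
have [[dr cr] _] := C1_profile_out 1.
have sN : (-1 : R) ^+ 2 = 1 by rewrite sqrrN expr1n.
have s1 : (1 : R) ^+ 2 = 1 by rewrite expr1n.
split.
- by move=> x; apply: is_derive_three_pieces => //;
    rewrite ?(phi_in_out sN) ?(profile_in_out sN) ?(phi_in_out s1) ?(profile_in_out s1).
- by apply: continuous_three_pieces => //;
    rewrite ?(phi_in_out sN) ?(profile_in_out sN) ?(phi_in_out s1) ?(profile_in_out s1).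
Qed.

Lemma profile_gt0 x : 0 < profile h x.
Proof. by rewrite /profile /three_pieces; case: ifP => _; [|case: ifP => _]; exact: expR_gt0. Qed.

(** The equation u_t = a u_xx for t^(-h/2) f (lam x / sqrt t), freed from its powers of t. *)
Lemma profile_ode x :
  - (x * dprofile h x) / 2 - h / 2 * profile h x = coef h x * (h / 4 * d2profile h x).
Proof.
have den s y : 1 <= s * y -> 2 * (1 + h * (s * y - 1)) ^+ 2 - 1 != 0.
  move=> sy; have z1 : 1 <= 1 + h * (s * y - 1) by rewrite lerDl mulr_ge0 ?subr_ge0// ltW.
  by rewrite gt_eqF// subr_gt0; nra.
rewrite /dprofile /profile /coef /d2profile /three_pieces.
case: (leP x (-1)) => [x1|x1]; [|case: (leP x 1) => x2].
- have D : 2 * (1 + h * ((-1) * x - 1)) ^+ 2 - 1 != 0 by apply: den; lra.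
  rewrite /coef_out /phi_out; field; by rewrite D gt_eqF.
- rewrite /phi_in /dphi_in /kappa; field.
  rewrite gt_eqF//= gt_eqF// ltr_pwDl// mulr_ge0 ?sqr_ge0// subr_ge0 ltW//.
  by case/andP: h01.
- have D : 2 * (1 + h * (1 * x - 1)) ^+ 2 - 1 != 0 by apply: den; rewrite mul1r ltW.
  rewrite /coef_out /phi_out; field.
  by rewrite -[x in 1 + h * (x - 1)]mul1r D gt_eqF.
Qed.

(** Outside [-1, 1] the estimates come from 1 <= z <= X and h X <= z, where z = 1 + h (X - 1): the
   quotient (2 X z - 1) / (2 z^2 - 1) lies between 1 and (2 - h) / h, the latter being attained at
   z = 1 if X is replaced by z / h. *)
Lemma coef_bounds x : 1 <= coef h x <= (2 - h) / h ^+ 3.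
Proof.
have hh1 : h < 1 by case/andP: h01.
have out s y : 1 <= s * y -> 1 <= coef_out h s y <= (2 - h) / h ^+ 3.
  rewrite /coef_out; set X := s * y => X1; set z := 1 + h * (X - 1).
  have z1 : 1 <= z by rewrite lerDl mulr_ge0 ?subr_ge0// ltW.
  have zX : z <= X by rewrite /z; nra.
  have hX : h * X <= z by rewrite /z; nra.
  have d0 : 0 < 2 * z ^+ 2 - 1 by rewrite subr_gt0; nra.
  have D0 : 0 < h ^+ 2 * (2 * z ^+ 2 - 1) by rewrite mulr_gt0// exprn_gt0.
  apply/andP; split.
    rewrite ler_pdivlMr// mul1r; apply: (@le_trans _ _ (2 * z ^+ 2 - 1)).
      by rewrite ler_piMl ?(ltW d0).
    by nra.
  rewrite ler_pdivrMr//.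
  have -> : (2 - h) / h ^+ 3 * (h ^+ 2 * (2 * z ^+ 2 - 1)) = (2 - h) * (2 * z ^+ 2 - 1) / h.
    by field; rewrite gt_eqF.
  rewrite ler_pdivlMr//.
  have : h * X * z <= z ^+ 2 by nra.
  have : 0 <= (1 - h) * (z ^+ 2 - 1) by rewrite mulr_ge0 ?subr_ge0 ?(ltW hh1)//; nra.
  by nra.
rewrite /coef /three_pieces; case: (leP x (-1)) => [x1|x1]; [|case: (leP x 1) => x2].
- by apply: out; lra.
- have kp : 0 < kappa h by exact: kappa_gt0.
  have xx : x ^+ 2 <= 1 by nra.
  rewrite lerDl mulr_ge0 ?sqr_ge0 ?(ltW kp)//=.
  apply: (@le_trans _ _ (1 + kappa h)); first by rewrite lerD2l; nra.
  have -> : 1 + kappa h = h ^+ 2 / h ^+ 3 by rewrite /kappa; field; rewrite gt_eqF.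
  by rewrite ler_pM2r ?invr_gt0 ?exprn_gt0//; have := hsq; case/andP: h01 => _; lra.
- by apply: out; lra.
Qed.

Lemma profile_ge x : -1 <= x <= 1 -> profile h 1 <= profile h x.
Proof.
have kp : 0 < kappa h by exact: kappa_gt0.
have inn y : -1 <= y <= 1 -> profile h y = profile_in h y.
  move=> /andP[y1 y2]; rewrite /profile /three_pieces y2; case: leP => // y3.
  have -> : y = -1 by lra.
  by rewrite -profile_in_out// sqrrN expr1n.
move=> x1; rewrite !inn//; last by lra.
rewrite ler_expR lerN2 ler_pM2l ?invr_gt0// ler_ln ?posrE ?kappa_den_gt0// lerD2l ler_pM2l//.
by nra.
Qed.

(** The exponent 4 leaves a factor (1 + x^2)^3 after one factor 1 + x^2 has been spent on the
   derivatives of the profile. *)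
Lemma profile_decay : exists C : R, forall x, (1 + x ^+ 2) ^+ 4 * profile h x <= C.
Proof.
have hh1 : h < 1 by case/andP: h01.
have kp : 0 < kappa h by exact: kappa_gt0.
pose C1 := expR (h ^+ 2) + expR (- shift_out h).
have hq : 0 <= h * (1 - h) by rewrite mulr_ge0 ?subr_ge0 ?(ltW h0) ?(ltW hh1).
have le1 x : profile h x <= C1 * expR (- (h ^+ 2 * x ^+ 2)).
  rewrite mulrDl -!expRD /profile /three_pieces.
  case: (leP x (-1)) => [x1|x1]; [|case: (leP x 1) => x2].
  - rewrite ler_wpDl ?expR_ge0// ler_expR -opprD lerN2.
    have : 0 <= h * (1 - h) * - x by rewrite mulr_ge0//; lra.
    by lra.
  - rewrite ler_wpDr ?expR_ge0// ler_expR.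
    have xx : x ^+ 2 <= 1 by nra.
    apply: (@le_trans _ _ 0); last first.
      have : 0 <= h ^+ 2 * (1 - x ^+ 2) by rewrite mulr_ge0 ?sqr_ge0 ?subr_ge0.
      lra.
    by rewrite oppr_le0 mulr_ge0 ?invr_ge0 ?(ltW kp)// ln_ge0// lerDl mulr_ge0 ?sqr_ge0// ltW.
  - rewrite ler_wpDl ?expR_ge0// ler_expR -opprD lerN2.
    have : 0 <= h * (1 - h) * x by rewrite mulr_ge0//; lra.
    by lra.
have C10 : 0 <= C1 by rewrite addr_ge0// expR_ge0.
exists (C1 * (4 / h ^+ 2) ^+ 4) => x.
apply: (le_trans (ler_wpM2l _ (le1 x))); first by rewrite exprn_ge0// addr_ge0// sqr_ge0.
rewrite mulrCA ler_wpM2l//.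
(* After taking fourth roots the claim reduces to 1 + y <= exp y. *)
pose y := h ^+ 2 * x ^+ 2 / 4.
have -> : expR (- (h ^+ 2 * x ^+ 2)) = expR (- y) ^+ 4.
  by rewrite -expRM_natl /y; congr expR; field.
rewrite -exprMn lerXn2r ?nnegrE//.
- by rewrite mulr_ge0 ?expR_ge0// addr_ge0// sqr_ge0.
- by rewrite divr_ge0// sqr_ge0.
rewrite expRN ler_pdivrMr ?expR_gt0//; apply: le_trans (ler_wpM2l _ (expR_ge1Dx y)); last first.
  by rewrite divr_ge0// sqr_ge0.
have -> : 4 / h ^+ 2 * (1 + y) = 4 / h ^+ 2 + x ^+ 2 by rewrite /y; field; rewrite gt_eqF.
rewrite lerD2r ler_pdivlMr ?exprn_gt0//; nra.
Qed.

(** All derivatives are the profile times polynomials in phi and phi', and |phi| <= 1 + |x|,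
   |phi'| <= 1. *)
Lemma derivatives_bound x :
  [/\ `|dprofile h x| <= 10 * (1 + x ^+ 2) * profile h x,
      `|x * dprofile h x| <= 10 * (1 + x ^+ 2) * profile h x &
      `|d2profile h x| <= 10 * (1 + x ^+ 2) * profile h x].
Proof.
have hh1 : h < 1 by case/andP: h01.
have kp : 0 < kappa h by exact: kappa_gt0.
have gen (y f phi dphi : R) : 0 < f -> `|phi| <= 1 + `|y| -> `|dphi| <= 1 ->
  [/\ `|- 2 * phi * f| <= 10 * (1 + y ^+ 2) * f,
      `|y * (- 2 * phi * f)| <= 10 * (1 + y ^+ 2) * f &
      `|(4 * phi ^+ 2 - 2 * dphi) * f| <= 10 * (1 + y ^+ 2) * f].
  move=> fp hp hd; have y0 := normr_ge0 y.
  have yy : y ^+ 2 = `|y| ^+ 2 by rewrite real_normK// num_real.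
  have p0 := normr_ge0 phi; have pp : phi ^+ 2 = `|phi| ^+ 2 by rewrite real_normK// num_real.
  have n2 : `|- 2 * phi| = 2 * `|phi| by rewrite normrM normrN normr_nat.
  split.
  - rewrite normrM (gtr0_norm fp) ler_pM2r// n2 yy; nra.
  - rewrite mulrA normrM (gtr0_norm fp) ler_pM2r// normrM n2 yy; nra.
  - rewrite normrM (gtr0_norm fp) ler_pM2r//; apply: le_trans (ler_normB _ _) _.
    have -> : `|4 * phi ^+ 2| = 4 * `|phi| ^+ 2 by rewrite normrM normrX ger0_norm.
    have -> : `|2 * dphi| = 2 * `|dphi| by rewrite normrM ger0_norm.
    have sq : `|phi| ^+ 2 <= (1 + `|y|) ^+ 2 by rewrite lerXn2r ?nnegrE ?addr_ge0.
    have := sqr_ge0 (1 - `|y|); have := sqr_ge0 `|y|; rewrite yy; nra.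
have out s : `|s| = 1 -> `|phi_out h s x| <= 1 + `|x|.
  move=> s1; rewrite /phi_out; apply: le_trans (ler_normD _ _) _.
  have y0 := normr_ge0 x.
  have hq : 0 <= h * (1 - h) by rewrite mulr_ge0 ?subr_ge0 ?(ltW h0) ?(ltW hh1).
  have hq1 : h * (1 - h) <= 1 by nra.
  rewrite [`|h ^+ 2 * x|]normrM [`|s * _|]normrM s1 mul1r (ger0_norm hq) (ger0_norm (sqr_ge0 h)).
  by have := hsq; nra.
have h2 : `|h ^+ 2| <= 1 by rewrite ger0_norm ?sqr_ge0.
rewrite /dprofile /profile /d2profile /three_pieces.
case: (leP x (-1)) => [x1|x1]; [|case: (leP x 1) => x2]; apply: gen => //.
- exact: expR_gt0.
- by apply: out; rewrite normrN normr1.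
- exact: expR_gt0.
- have d1 : 1 <= 1 + kappa h * x ^+ 2 by rewrite lerDl mulr_ge0 ?sqr_ge0// ltW.
  have d0 : 0 < 1 + kappa h * x ^+ 2 by lra.
  rewrite /phi_in normrM normfV (gtr0_norm d0) ler_pdivrMr//.
  by have := normr_ge0 x; nra.
- have d1 : 1 <= 1 + kappa h * x ^+ 2 by rewrite lerDl mulr_ge0 ?sqr_ge0// ltW.
  have d0 : 0 < 1 + kappa h * x ^+ 2 by lra.
  rewrite /dphi_in normrM normfV (gtr0_norm (exprn_gt0 _ d0)) ler_pdivrMr ?exprn_gt0//.
  by rewrite mul1r ler_norml; apply/andP; split; nra.
- exact: expR_gt0.
- by apply: out; rewrite normr1.
Qed.
End Profile.

(** * Self-similar functions *)

Definition selfsimilar (R : realType) (lam b : R) (k : R -> R) (z : R * R) : R :=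
  if 0 < z.1 then z.1 `^ (- b) * k (lam * z.1 `^ (- 2^-1) * z.2) else 0.

Lemma powR_invsqrt_sqr (R : realType) (t : R) : 0 < t -> (t `^ (- 2^-1)) ^+ 2 = t^-1.
Proof.
move=> t0; rewrite -powR_mulrn ?powR_ge0// -powRrM.
by rewrite mulNr mulVf// powR_inv1// ltW.
Qed.

(** The cube turns into a factor t^3 at fixed x <> 0, enough to beat t^(-2). *)
Definition rapid_decay (R : realType) (k : R -> R) : Prop :=
  exists C : R, forall x : R, (1 + x ^+ 2) ^+ 3 * `|k x| <= C.

Lemma measurable_selfsimilar (R : realType) (lam b : R) (k : R -> R) :
  measurable_fun setT k -> measurable_fun setT (selfsimilar lam b k).
Proof.
move=> mk; have mp c : measurable_fun setT (fun z : R * R => z.1 `^ c).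
  by apply: (measurableT_comp (@measurable_powR R c)); exact: measurable_fst.
apply: measurable_fun_ifT => //.
  by apply: measurable_fun_ltr => //; exact: measurable_fst.
apply: measurable_funM; first exact: mp.
apply: (measurableT_comp mk); apply: measurable_funM; last exact: measurable_snd.
by apply: measurable_funM => //; exact: mp.
Qed.

(** At fixed x <> 0 the argument of k tends to infinity as t decreases to 0, like t^(-1/2). *)
Lemma selfsimilar_flat (R : realType) (lam b x : R) (k : R -> R) (n : nat) :
  0 < lam -> x != 0 -> rapid_decay k -> b + n%:R <= 3 ->
  exists2 K : R, 0 <= K & forall t, `|t| <= 1 -> `|selfsimilar lam b k (t, x)| <= K * `|t| ^+ n.
Proof.
move=> l0 x0 [C kC] bn.
have C0 : 0 <= C by apply: le_trans (kC 0); rewrite mulr_ge0// exprn_ge0// addr_ge0// sqr_ge0.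
have lx : 0 < (lam * x) ^+ 2 by rewrite exprn_even_gt0//= mulf_neq0// gt_eqF.
have l6 : 0 < (lam * x) ^+ 6 by rewrite (exprM _ 2 3) exprn_gt0.
exists (C / (lam * x) ^+ 6) => [|t t1]; first by rewrite divr_ge0// exprn_even_ge0.
rewrite /selfsimilar /=; case: ifP => [t0|_]; last first.
  by rewrite normr0 mulr_ge0 ?exprn_ge0// divr_ge0// exprn_even_ge0.
rewrite gtr0_norm// in t1 *; rewrite normrM ger0_norm ?powR_ge0//.
set y := _ * x; have y2 : y ^+ 2 = (lam * x) ^+ 2 / t.
  by rewrite /y mulrAC exprMn powR_invsqrt_sqr.
have yk : `|k y| <= C * (t ^+ 3 / (lam * x) ^+ 6).
  have : (y ^+ 2) ^+ 3 * `|k y| <= C.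
    apply: le_trans (kC y); rewrite ler_wpM2r// lerXn2r ?nnegrE ?sqr_ge0 ?addr_ge0 ?sqr_ge0//.
    by rewrite lerDr.
  rewrite y2 expr_div_n -exprM mulrC -ler_pdivlMr; last first.
    by rewrite divr_gt0// exprn_gt0.
  by rewrite invf_div.
apply: (le_trans (ler_wpM2l (powR_ge0 _ _) yk)).
have -> : t `^ (- b) * (C * (t ^+ 3 / (lam * x) ^+ 6)) = C / (lam * x) ^+ 6 * t `^ (3 - b).
  rewrite powRD ?(gt_eqF t0) ?implybT// -(powR_mulrn 3) ?(ltW t0)//.
  by field; rewrite x0 gt_eqF.
rewrite ler_wpM2l//; first by rewrite divr_ge0// exprn_even_ge0.
rewrite -(powR_mulrn n) ?(ltW t0)//; apply: ger_powR; first by rewrite t0.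
by lra.
Qed.

Lemma cvg0_linear (R : realType) (F : R -> R) (L : R) :
  (forall t, `|t| <= 1 -> `|F t| <= L * `|t| ^+ 1) -> F t @[t --> 0] --> (0 : R).
Proof.
move=> FL; apply/cvgr0Pnorm_lt => e e0; have L1 : 0 < `|L| + 1 by rewrite ltr_wpDl.
apply/nbhs_ballP; exists (Num.min 1 (e / (`|L| + 1))) => /=.
  by rewrite lt_min ltr01 divr_gt0.
move=> t; rewrite /ball/= sub0r normrN lt_min => /andP[/ltW t2 t1].
apply: (le_lt_trans (FL t t2)); rewrite expr1.
apply: (@le_lt_trans _ _ ((`|L| + 1) * `|t|)).
  by rewrite ler_wpM2r// (le_trans (ler_norm _))// lerDl.
by rewrite mulrC -ltr_pdivlMr.
Qed.

Lemma is_derive0_quadratic (R : realType) (F : R -> R) (K : R) : F 0 = 0 ->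
  (forall t, `|t| <= 1 -> `|F t| <= K * `|t| ^+ 2) -> is_derive (0 : R) 1 F 0.
Proof.
move=> F0 FK.
have cv : h^-1 *: ((F \o shift 0) (h *: (1:R)) - F 0) @[h --> 0^'] --> (0 : R).
  apply: cvg_within_filter || apply: cvg_dnbhs.
  apply: (@cvg0_linear R _ K) => t t1.
  rewrite /= F0 addr0 subr0 scaler1 /GRing.scale/= normrM normfV expr1.
  have [->|t0] := eqVneq t 0; first by rewrite normr0 invr0 mul0r mulr0.
  rewrite mulrC ler_pdivrMr ?normr_gt0// -mulrA -expr2; exact: FK.
by apply: DeriveDef; [apply/cvg_ex; exists 0|exact/cvg_lim].
Qed.

(** Off the line x = 0 the extension by zero to t <= 0 is of class C^1: at t = 0 the function is
   O(t^2) and its derivative is O(t). *)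
Lemma selfsimilar_C1_time (R : realType) (lam b x : R) (k k' : R -> R) :
  0 < lam -> x != 0 -> b <= 1 -> C1_pair k k' ->
  rapid_decay k -> rapid_decay (fun y => - (y * k' y) / 2 - b * k y) ->
  C1_pair (fun t => selfsimilar lam b k (t, x))
          (fun t => selfsimilar lam (b + 1) (fun y => - (y * k' y) / 2 - b * k y) (t, x)).
Proof.
move=> l0 x0 b1 [dk ck'] rk rk'.
have ck := C1_pair_continuous (conj dk ck').
pose kk y := - (y * k' y) / 2 - b * k y; rewrite -/kk.
have ckk : continuous kk.
  have c1 : continuous (fun y : R => y * k' y).
    by move=> y; apply: cvgM; [exact: cvg_id|exact: ck'].
  move=> y; have c2 : - (z * k' z) / 2 @[z --> y] --> - (y * k' y) / 2.
    by apply: cvgM; [apply: cvgN; exact: c1|exact: cvg_cst].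
  have c3 : b * k z @[z --> y] --> b * k y by apply: cvgM; [exact: cvg_cst|exact: ck].
  exact: (cvgB c2 c3).
have cpow c t : 0 < t -> {for t, continuous (fun t : R => t `^ c)}.
  by move=> t0; exact: is_derive_continuous (is_derive1_powR c t0).
have [K K0 flat2] : exists2 K : R, 0 <= K &
    forall t, `|t| <= 1 -> `|selfsimilar lam b k (t, x)| <= K * `|t| ^+ 2.
  by apply: selfsimilar_flat => //; lra.
have [L L0 flat1] : exists2 K : R, 0 <= K &
    forall t, `|t| <= 1 -> `|selfsimilar lam (b + 1) kk (t, x)| <= K * `|t| ^+ 1.
  by apply: selfsimilar_flat => //; lra.
split => t; have [t0|t0|->] := ltgtP t 0.
- apply: (near_eq_is_derive (f := cst 0)).
    near=> y; rewrite /selfsimilar /= ifF//; apply/negbTE.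
    by rewrite -leNgt ltW//; near: y; exact: lt_nbhsl.
  by rewrite /selfsimilar /= ltNge (ltW t0)/=; exact: is_derive_cst.
- apply: (near_eq_is_derive (f := fun t => t `^ (- b) * k (lam * t `^ (- 2^-1) * x))).
    by near=> y; rewrite /selfsimilar /= ifT//; near: y; exact: lt_nbhsr.
  have d1 := is_derive1_powR (- b) t0; have d2 := is_derive1_powR (- 2^-1) t0.
  have d3 := fderiv_mul (fderiv_mul (fderiv_cst t lam) d2) (fderiv_cst t x).
  have d4 := @fderiv_comp R k (fun t => lam * t `^ (- 2^-1) * x) _ _ _ (dk _) d3.
  apply: (is_derive_eq (fderiv_mul d1 d4)); rewrite /selfsimilar /= t0 /kk.
  have pB c : t `^ (c - 1) = t `^ c / t.
    by rewrite powRB ?(gt_eqF t0) ?implybT// powRr1// ltW.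
  by rewrite opprD !pB; field; rewrite gt_eqF.
- rewrite [selfsimilar _ _ _ (0, x)]/selfsimilar /= ltxx.
  by apply: (@is_derive0_quadratic R _ K) => //; rewrite /selfsimilar /= ltxx.
- rewrite /prop_for /continuous_at [selfsimilar _ _ _ (t, x)]/selfsimilar /= ltNge (ltW t0)/=.
  apply: cvg_near_cst; near=> y.
  by rewrite /selfsimilar /= ifF//; apply/negbTE; rewrite -leNgt ltW//; near: y; exact: lt_nbhsl.
- rewrite /prop_for /continuous_at [selfsimilar _ _ _ (t, x)]/selfsimilar /= t0.
  apply: (@cvg_trans _ ((fun t => t `^ (- (b + 1)) * kk (lam * t `^ (- 2^-1) * x)) @ t)).
    apply: near_eq_cvg; near=> y.
    by rewrite /selfsimilar /= ifT//; near: y; exact: lt_nbhsr.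
  have e1 : {for t, continuous (fun s : R => lam * s `^ (- 2^-1) * x)}.
    by apply: cvgM; [apply: cvgM; [exact: cvg_cst|exact: cpow]|exact: cvg_cst].
  have e2 : {for t, continuous (fun s : R => kk (lam * s `^ (- 2^-1) * x))}.
    by apply: (@continuous_comp _ _ _ (fun s : R => lam * s `^ (- 2^-1) * x) kk);
      [exact: e1|exact: ckk].
  exact: (cvgM (cpow (- (b + 1)) t t0) e2).
- rewrite /prop_for /continuous_at [selfsimilar _ _ _ (0, x)]/selfsimilar /= ltxx.
  exact: (cvg0_linear flat1).
Unshelve. all: by end_near. Qed.

(** For t < 2 a smaller power of 1/t is bounded by a multiple of a larger one, so that the solution
   and all its derivatives obey the same bound. *)
Lemma dominated_selfsimilar (R : realType) (lam b B : R) (k : R -> R) :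
  b <= B -> rapid_decay k -> dominated lam B (selfsimilar lam b k).
Proof.
move=> bB [C kC].
have C0 : 0 <= C by apply: le_trans (kC 0); rewrite mulr_ge0// exprn_ge0// addr_ge0// sqr_ge0.
exists (2 `^ (B - b) * C) => t x /andP[t0 t2]; rewrite /selfsimilar /= t0.
set y := _ * x; have d1 : 1 <= 1 + y ^+ 2 by rewrite lerDl sqr_ge0.
have d0 : 0 < 1 + y ^+ 2 by rewrite (lt_le_trans _ d1).
have ky : `|k y| <= C / (1 + y ^+ 2).
  rewrite ler_pdivlMr// mulrC; apply: le_trans (kC y); rewrite ler_wpM2r//.
  by rewrite -[leLHS]expr1 ler_weXn2l.
rewrite normrM ger0_norm ?powR_ge0//; apply: (le_trans (ler_wpM2l (powR_ge0 _ _) ky)).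
rewrite !mulrA ler_wpM2r ?invr_ge0 ?(ltW d0)// -mulrA [C * _]mulrC mulrA ler_wpM2r//.
have -> : t `^ (- b) = t `^ (B - b) * t `^ (- B).
  by rewrite -powRD ?(gt_eqF t0) ?implybT//; congr (_ `^ _); ring.
rewrite ler_wpM2r ?powR_ge0//.
by apply: ge0_ler_powR; rewrite ?nnegrE ?subr_ge0 ?(ltW t0) ?(ltW t2).
Qed.

Lemma dominatedM (R : realType) (lam B : R) (e : R -> R) (w : R * R -> R) :
  (forall t, `|e t| <= 1) -> dominated lam B w -> dominated lam B (fun z => e z.1 * w z).
Proof.
move=> e1 [C wC]; exists C => t x t02 /=; apply: le_trans (wC t x t02).
by rewrite normrM ler_piMl.
Qed.

Lemma dominatedD (R : realType) (lam B : R) (v w : R * R -> R) :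
  dominated lam B v -> dominated lam B w -> dominated lam B (fun z => v z + w z).
Proof.
move=> [C vC] [D wD]; exists (C + D) => t x t02; apply: le_trans (ler_normD _ _) _.
by rewrite !mulrDl lerD ?vC ?wD.
Qed.

(** * The solution *)

Definition cutoff (R : realType) (t : R) : R := if t <= 1 then 1 else if t <= 2 then 2 - t else 0.
Definition dcutoff (R : realType) (t : R) : R := if t <= 1 then 0 else if t < 2 then -1 else 0.

Lemma cutoff_le1 (R : realType) (t : R) : `|cutoff t| <= 1.
Proof.
rewrite /cutoff; case: (leP t 1) => [_|t1]; first by rewrite normr1.
case: (leP t 2) => [t2|_]; last by rewrite normr0.
by rewrite ler_norml; apply/andP; split; lra.
Qed.

Lemma dcutoff_le1 (R : realType) (t : R) : `|dcutoff t| <= 1.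
Proof.
rewrite /dcutoff; case: (leP t 1) => [_|t1]; first by rewrite normr0.
by case: (ltP t 2) => [t2|_]; rewrite ?normr0// normrN normr1.
Qed.

Lemma measurable_cutoff (R : realType) : measurable_fun setT (@cutoff R).
Proof.
apply: measurable_fun_ifT => //; first exact: measurable_fun_ler.
apply: measurable_fun_ifT => //; first exact: measurable_fun_ler.
exact: measurable_funB.
Qed.

Lemma measurable_dcutoff (R : realType) : measurable_fun setT (@dcutoff R).
Proof.
apply: measurable_fun_ifT => //; first exact: measurable_fun_ler.
by apply: measurable_fun_ifT => //; exact: measurable_fun_ltr.
Qed.

Lemma C1_pair_cst (R : realType) (c : R) : C1_pair (fun=> c) (fun=> 0).
Proof. by split=> x; [exact: fderiv_cst|exact: cvg_cst]. Qed.

Lemma C1_pair_scale (R : realType) (m c : R) (k k' : R -> R) : C1_pair k k' ->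
  C1_pair (fun x => c * k (m * x)) (fun x => c * m * k' (m * x)).
Proof.
move=> [dk ck]; split=> x.
  have d := fderiv_mul (fderiv_cst x m) (fderiv_id x).
  have d2 := @fderiv_comp R k (fun x => m * x) _ _ _ (dk _) d.
  by apply: (is_derive_eq (fderiv_mul (fderiv_cst x c) d2)); ring.
apply: cvgM; first exact: cvg_cst.
apply: (@continuous_comp _ _ _ (fun x => m * x) k'); last exact: ck.
by apply: cvgM; [exact: cvg_cst|exact: cvg_id].
Qed.

Lemma weak_pair0 (R : realType) : weak_pair (fun=> 0 : R) (fun=> 0).
Proof. exact: weak_pair_C1 (C1_pair_cst 0). Qed.

(** Inversion is discontinuous at 0, but 1/y = y * (y^2)^(-1) with a real power, which is
   measurable; the convention 1/0 = 0 agrees on both sides. *)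
Lemma measurable_fun_inv (R : realType) (f : R -> R) :
  measurable_fun setT f -> measurable_fun setT (fun x => (f x)^-1).
Proof.
move=> mf; have -> : (fun x => (f x)^-1) = (fun x => f x * (f x ^+ 2) `^ (-1)).
  apply/funext => x; rewrite powR_inv1 ?sqr_ge0//.
  by have [->|fx] := eqVneq (f x) 0; [rewrite invr0 mul0r|field].
apply: measurable_funM => //.
by apply: (measurableT_comp (@measurable_powR R (-1))); exact: measurable_funX.
Qed.

Lemma measurable_coef (R : realType) (h : R) : measurable_fun setT (coef h).
Proof.
have mout s : measurable_fun setT (coef_out h s).
  have ms : measurable_fun setT (fun x => s * x) by exact: measurable_funM.
  have mz : measurable_fun setT (fun x => 1 + h * (s * x - 1)).
    by apply: measurable_funD => //; apply: measurable_funM => //; exact: measurable_funB.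
  apply: measurable_funM.
    by apply: measurable_funB => //; apply: measurable_funM => //; exact: measurable_funM.
  apply: measurable_fun_inv; apply: measurable_funM => //; apply: measurable_funB => //.
  by apply: measurable_funM => //; exact: measurable_funX.
apply: measurable_three_pieces => //.
by apply: measurable_funD => //; apply: measurable_funM => //; exact: measurable_funX.
Qed.

Section Solution.
Variables (R : realType) (h : R).
Hypothesis h01 : 0 < h < 1.
Let h0 : 0 < h. Proof. by case/andP: h01. Qed.

(** Multiplies the coefficient by 4/h, so that its lower bound becomes 1. *)
Definition xscale : R := Num.sqrt h / 2.
(** The profile of the time derivative. *)
Definition profile_t (y : R) : R := - (y * dprofile h y) / 2 - h / 2 * profile h y.

Definition sol : R * R -> R := fun z => cutoff z.1 * selfsimilar xscale (h / 2) (profile h) z.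
Definition sol_t : R * R -> R := fun z =>
  cutoff z.1 * selfsimilar xscale (h / 2 + 1) profile_t z +
  dcutoff z.1 * selfsimilar xscale (h / 2) (profile h) z.
Definition sol_x : R * R -> R := fun z =>
  cutoff z.1 * selfsimilar xscale (h / 2 + 2^-1) (fun y => xscale * dprofile h y) z.
Definition sol_xx : R * R -> R := fun z =>
  cutoff z.1 * selfsimilar xscale (h / 2 + 1) (fun y => h / 4 * d2profile h y) z.
Definition diffusion : R * R -> R := fun z => coef h (xscale * z.1 `^ (- 2^-1) * z.2).

Lemma xscale_gt0 : 0 < xscale. Proof. by rewrite divr_gt0// sqrtr_gt0. Qed.

Lemma xscale_sqr : xscale ^+ 2 = h / 4.
Proof. by rewrite expr_div_n sqr_sqrtr ?ltW//; congr (_ / _); ring. Qed.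

Lemma rapid_decay_of_profile_bound (A : R) (k : R -> R) : 0 <= A ->
  (forall x, `|k x| <= A * ((1 + x ^+ 2) * profile h x)) -> rapid_decay k.
Proof.
move=> A0 kA; have [C hC] := profile_decay h01; exists (A * C) => x.
have p0 : 0 <= (1 + x ^+ 2) ^+ 3 by rewrite exprn_ge0// addr_ge0// sqr_ge0.
apply: (le_trans (ler_wpM2l p0 (kA x))).
by rewrite mulrCA ler_wpM2l// mulrA -exprSr.
Qed.

Lemma rapid_decay_profiles : [/\ rapid_decay (profile h), rapid_decay profile_t,
  rapid_decay (fun y => xscale * dprofile h y) & rapid_decay (fun y => h / 4 * d2profile h y)].
Proof.
have p1 x : `|profile h x| <= (1 + x ^+ 2) * profile h x.
  rewrite gtr0_norm ?profile_gt0// ler_peMl ?(ltW (profile_gt0 _ _))//.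
  by rewrite lerDl sqr_ge0.
have hh1 : h < 1 by case/andP: h01.
split.
- by apply: (@rapid_decay_of_profile_bound 1) => // x; rewrite mul1r.
- apply: (@rapid_decay_of_profile_bound 10) => // x; have [_ d1 _] := derivatives_bound h01 x.
  apply: le_trans (ler_normB _ _) _.
  have -> : `|- (x * dprofile h x) / 2| = `|x * dprofile h x| / 2.
    by rewrite normrM normrN normfV normr_nat.
  have -> : `|h / 2 * profile h x| = h / 2 * `|profile h x|.
    by rewrite normrM (gtr0_norm (divr_gt0 h0 _)).
  have := p1 x; have := normr_ge0 (profile h x); move: d1; rewrite -!mulrA.
  move: `|profile h x| (_ * profile h x) => a c; nra.
- apply: (@rapid_decay_of_profile_bound (xscale * 10)) => [|x].
    by rewrite mulr_ge0 ?(ltW xscale_gt0).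
  have [d1 _ _] := derivatives_bound h01 x.
  rewrite normrM (gtr0_norm xscale_gt0).
  by apply: le_trans (ler_wpM2l (ltW xscale_gt0) d1) _; rewrite !mulrA.
- apply: (@rapid_decay_of_profile_bound (h / 4 * 10)) => [|x].
    by rewrite mulr_ge0 ?divr_ge0 ?(ltW h0).
  have [_ _ d1] := derivatives_bound h01 x.
  have h4 : 0 < h / 4 by rewrite divr_gt0.
  by rewrite normrM (gtr0_norm h4); apply: le_trans (ler_wpM2l (ltW h4) d1) _; rewrite !mulrA.
Qed.

Let mf0 : measurable_fun setT (profile h).
Proof. by apply: continuous_measurable_fun; exact: C1_pair_continuous (C1_profile h01). Qed.

Let mf1 : measurable_fun setT (dprofile h).
Proof. by case: (C1_profile h01) => _ /continuous_measurable_fun. Qed.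

Let mf2 : measurable_fun setT (d2profile h).
Proof.
apply: measurable_three_pieces; apply: continuous_measurable_fun.
- by have [_ [_ c]] := C1_profile_out h (-1).
- by have [_ [_ c]] := C1_profile_in h01.
- by have [_ [_ c]] := C1_profile_out h 1.
Qed.

Let mfst (e : R -> R) : measurable_fun setT e -> measurable_fun setT (fun z : R * R => e z.1).
Proof. by move=> me; apply: (measurableT_comp me); exact: measurable_fst. Qed.

Lemma measurable_sol : [/\ measurable_fun setT sol, measurable_fun setT sol_t,
  measurable_fun setT sol_x & measurable_fun setT sol_xx].
Proof.
have me := mfst (@measurable_cutoff R); have md := mfst (@measurable_dcutoff R).
have ms b k : measurable_fun setT k -> measurable_fun setT (selfsimilar xscale b k).
  exact: measurable_selfsimilar.
have mkt : measurable_fun setT profile_t.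
  apply: measurable_funB; last exact: measurable_funM.
  apply: measurable_funM => //; apply: measurable_funN; exact: measurable_funM.
split.
- by apply: measurable_funM => //; exact: ms.
- by apply: measurable_funD; apply: measurable_funM => //; exact: ms.
- by apply: measurable_funM => //; apply: ms; exact: measurable_funM.
- by apply: measurable_funM => //; apply: ms; exact: measurable_funM.
Qed.

Lemma dominated_sol : let D := dominated xscale (h / 2 + 1) in
  [/\ D sol, D sol_t, D sol_x & D sol_xx].
Proof.
move=> D; have [r1 r2 r3 r4] := rapid_decay_profiles.
have De b k : b <= h / 2 + 1 -> rapid_decay k -> D (fun z => cutoff z.1 * selfsimilar xscale b k z).
  by move=> bB rk; apply: dominatedM; [exact: cutoff_le1|exact: dominated_selfsimilar].
split; [| | |]; try (by apply: De => //; lra).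
apply: dominatedD; first exact: De.
apply: dominatedM; first exact: dcutoff_le1.
by apply: dominated_selfsimilar => //; lra.
Qed.

Lemma sol_out (t x : R) : ~~ (0 < t < 2) ->
  [/\ sol (t, x) = 0, sol_t (t, x) = 0, sol_x (t, x) = 0 & sol_xx (t, x) = 0].
Proof.
rewrite negb_and -!leNgt => /orP[t0|t2].
  by rewrite /sol /sol_t /sol_x /sol_xx /selfsimilar /= ltNge t0/= !mulr0 addr0.
have e0 : cutoff t = 0.
  rewrite /cutoff ifF; last by apply/negbTE; rewrite -ltNge; lra.
  by case: (leP t 2) => // t2'; lra.
have d0 : dcutoff t = 0.
  by rewrite /dcutoff ltNge t2/=; case: ifP.
by rewrite /sol /sol_t /sol_x /sol_xx /= e0 d0 !mul0r addr0.
Qed.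

Lemma sol_Lfun (q : R) : 1 <= q -> (h / 2 + 1) * q < 3 / 2 ->
  [/\ sol \in Lfun (leb2 R) q%:E, sol_x \in Lfun (leb2 R) q%:E,
      sol_xx \in Lfun (leb2 R) q%:E & sol_t \in Lfun (leb2 R) q%:E].
Proof.
move=> q1 hq; have [m1 m2 m3 m4] := measurable_sol; have [d1 d2 d3 d4] := dominated_sol.
by split; apply: (dominated_Lfun xscale_gt0 q1 hq) => // t x /(sol_out x)[].
Qed.

Lemma sol_integrable : let I (w : R * R -> R) := (leb2 R).-integrable setT (EFin \o w) in
  [/\ I sol, I sol_t, I sol_x & I sol_xx].
Proof.
have hh1 : h < 1 by case/andP: h01.
have [|l1 l2 l3 l4] := @sol_Lfun 1 (lexx 1); first by rewrite mulr1; lra.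
by split; apply/Lfun1_integrable.
Qed.

Let sN : (-1 : R) ^+ 2 = 1. Proof. by rewrite sqrrN expr1n. Qed.
Let s1 : (1 : R) ^+ 2 = 1. Proof. by rewrite expr1n. Qed.

Lemma dprofile_in (y : R) : -1 <= y <= 1 -> dprofile h y = - 2 * phi_in h y * profile_in h y.
Proof.
move=> /andP[y1 y2]; rewrite /dprofile /three_pieces y2; case: leP => // y3.
have -> : y = -1 by lra.
by rewrite (phi_in_out h01 sN) (profile_in_out _ sN).
Qed.

Lemma dprofile_right (y : R) : 1 <= y -> dprofile h y = - 2 * phi_out h 1 y * profile_out h 1 y.
Proof.
move=> y1; rewrite /dprofile /three_pieces; case: leP => [y2|_]; first by exfalso; lra.
case: leP => // y2; have -> : y = 1 by lra.
by rewrite (phi_in_out h01 s1) (profile_in_out _ s1).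
Qed.

(** The pieces are cut at the two kinks t = 1 and t = 2 of the cutoff. *)
Lemma weak_pair_sol_t (x : R) : x != 0 ->
  weak_pair (fun t => sol (t, x)) (fun t => sol_t (t, x)).
Proof.
move=> x0; have [r1 r2 _ _] := rapid_decay_profiles; have [m1 m2 _ _] := measurable_sol.
have C : C1_pair (fun t => selfsimilar xscale (h / 2) (profile h) (t, x))
                 (fun t => selfsimilar xscale (h / 2 + 1) profile_t (t, x)).
  apply: selfsimilar_C1_time => //; [exact: xscale_gt0| |exact: C1_profile].
  by case/andP: h01; lra.
have C2 : C1_pair (fun t : R => 2 - t) (fun=> -1).
  split=> t; last exact: cvg_cst.
  have d : is_derive t 1 (fun t : R => 2 - t) (0 + (- 1)).
    exact: (fderiv_add (fderiv_cst t 2) (fderiv_opp (fderiv_id t))).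
  by apply: (is_derive_eq d); ring.
have l12 : 1 < 2 :> R by rewrite ltr1n.
apply: (weak_pair_pieces l12 C (C1_pair_mul C2 C) (C1_pair_cst 0)).
- exact: (measurableT_comp m1 (pair2_measurable x)).
- exact: (measurableT_comp m2 (pair2_measurable x)).
- by move=> t t1; rewrite /sol /cutoff /= t1 mul1r.
- move=> t /andP[t1 t2]; rewrite /sol /cutoff /= t2; case: leP => // t1'.
  by have -> : t = 1 by [lra]; congr (_ * _); ring.
- move=> t t2; rewrite /sol /cutoff /= leNgt (lt_le_trans l12 t2)/=.
  case: leP => [t2'|]; last by rewrite mul0r.
  by have -> : t = 2 by [lra]; rewrite subrr mul0r.
- by move=> t t1; rewrite /sol_t /cutoff /dcutoff /= (ltW t1) mul1r mul0r addr0.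
- move=> t /andP[t1 t2]; rewrite /sol_t /cutoff /dcutoff /= leNgt t1/= (ltW t2) t2.
  by [].
- move=> t t2; rewrite /sol_t /cutoff /dcutoff /= leNgt (lt_trans l12 t2)/= leNgt t2/=.
  rewrite ltNge (ltW t2)/=.
  by rewrite !mul0r addr0.
Qed.

Lemma weak_pair_sol_x (t : R) : weak_pair (fun x => sol (t, x)) (fun x => sol_x (t, x)).
Proof.
have [t02|nt] := boolP (0 < t < 2); last first.
  have -> : (fun x => sol (t, x)) = fun=> 0 by apply/funext => x; have [] := sol_out x nt.
  have -> : (fun x => sol_x (t, x)) = fun=> 0 by apply/funext => x; have [] := sol_out x nt.
  exact: weak_pair0.
have /andP[t0 t2] := t02.
have C := C1_pair_scale (xscale * t `^ (- 2^-1)) (cutoff t * t `^ (- (h / 2))) (C1_profile h01).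
have -> : (fun x => sol (t, x)) =
    (fun x => cutoff t * t `^ (- (h / 2)) * profile h (xscale * t `^ (- 2^-1) * x)).
  by apply/funext => x; rewrite /sol /selfsimilar /= t0 mulrA.
have -> : (fun x => sol_x (t, x)) = (fun x => cutoff t * t `^ (- (h / 2)) *
    (xscale * t `^ (- 2^-1)) * dprofile h (xscale * t `^ (- 2^-1) * x)).
  apply/funext => x; rewrite /sol_x /selfsimilar /= t0 opprD.
  by rewrite powRD ?(gt_eqF t0) ?implybT//; ring.
exact: weak_pair_C1.
Qed.

(** The pieces are cut where the argument of the profile is 1 or -1, the jumps of f''. *)
Lemma weak_pair_sol_xx (t : R) : weak_pair (fun x => sol_x (t, x)) (fun x => sol_xx (t, x)).
Proof.
have [_ _ m1 m2] := measurable_sol.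
have [t02|nt] := boolP (0 < t < 2); last first.
  have -> : (fun x => sol_x (t, x)) = fun=> 0 by apply/funext => x; have [] := sol_out x nt.
  have -> : (fun x => sol_xx (t, x)) = fun=> 0 by apply/funext => x; have [] := sol_out x nt.
  exact: weak_pair0.
have /andP[t0 t2] := t02.
set m := xscale * t `^ (- 2^-1).
have m0 : 0 < m by rewrite mulr_gt0 ?xscale_gt0// powR_gt0.
pose c := cutoff t * t `^ (- (h / 2 + 2^-1)) * xscale.
have [_ CL] := C1_profile_out h (-1); have [_ CI] := C1_profile_in h01.
have [_ CR] := C1_profile_out h 1.
have Fx x : sol_x (t, x) = c * dprofile h (m * x).
  by rewrite /sol_x /selfsimilar /= t0 /c; ring.
have Fxx x : sol_xx (t, x) = c * m * d2profile h (m * x).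
  rewrite /sol_xx /selfsimilar /= t0 -/m -xscale_sqr.
  have -> : t `^ (- (h / 2 + 1)) = t `^ (- (h / 2 + 2^-1)) * t `^ (- 2^-1).
    by rewrite -powRD ?(gt_eqF t0) ?implybT//; congr (_ `^ _); field.
  by rewrite /c /m; ring.
have mm : - m^-1 < m^-1 by rewrite gtrN// invr_gt0.
apply: (weak_pair_pieces mm (C1_pair_scale m c CL) (C1_pair_scale m c CI) (C1_pair_scale m c CR)).
- exact: (measurableT_comp m1 (pair1_measurable t)).
- exact: (measurableT_comp m2 (pair1_measurable t)).
- move=> x xm; rewrite Fx /dprofile /three_pieces ifT//.
  by rewrite -ler_pdivlMl// mulrN1.
- move=> x /andP[x1 x2]; rewrite Fx dprofile_in//.
  by rewrite -ler_pdivrMl// mulrN1 x1/= -ler_pdivlMl// mulr1.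
- move=> x xm; rewrite Fx dprofile_right//.
  by rewrite -ler_pdivrMl// mulr1.
- move=> x xm; rewrite Fxx /d2profile /three_pieces ifT//.
  by rewrite -ler_pdivlMl// mulrN1 ltW.
- move=> x /andP[x1 x2]; rewrite Fxx /d2profile /three_pieces ifF; last first.
    by apply/negbTE; rewrite -ltNge -ltr_pdivrMl// mulrN1.
  by rewrite ifT// -ler_pdivlMl// mulr1 ltW.
- move=> x xm; have mx : 1 < m * x by rewrite -ltr_pdivrMl// mulr1.
  rewrite Fxx /d2profile /three_pieces ifF; last by apply/negbTE; rewrite -ltNge; lra.
  by rewrite ifF//; apply/negbTE; rewrite -ltNge.
Qed.

Lemma weak_deriv_sol : [/\ weak_deriv (@Dt R) setT sol sol_t,
  weak_deriv (@Dx R) setT sol sol_x & weak_deriv (@Dx R) setT sol_x sol_xx].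
Proof.
have [i1 i2 i3 i4] := sol_integrable; split.
- by apply: weak_deriv_t => // x; exact: weak_pair_sol_t.
- by apply: weak_deriv_x => // t _; exact: weak_pair_sol_x.
- by apply: weak_deriv_x => // t _; exact: weak_pair_sol_xx.
Qed.

Lemma W12_0_Q_sol (p : R) : 1 <= p -> (h / 2 + 1) * p < 3 / 2 -> W12_0_Q p sol.
Proof.
move=> p1 hp; exists sol; split => //.
  by exists sol_t, sol_x, sol_xx; split; [exact: weak_deriv_sol|exact: sol_Lfun].
by move=> [t x] /= t0; rewrite /sol /selfsimilar /= ltNge t0/= mulr0.
Qed.

Lemma solves_sol : solves_in_Q diffusion sol.
Proof.
have [w1 w2 w3] := weak_deriv_sol; exists sol_t, sol_x, sol_xx; split.
- by apply: weak_deriv_Q w1 => phi z /test_function0[].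
- by apply: weak_deriv_Q w2 => phi z /test_function0[].
- by apply: weak_deriv_Q w3 => phi z /test_function0[].
apply: aeW => -[t x] /andP[/= t0 t1].
rewrite /sol_t /sol_xx /selfsimilar /diffusion /= t0 /cutoff /dcutoff (ltW t1) !mul1r mul0r addr0.
by rewrite /profile_t profile_ode// mulrCA.
Qed.

Lemma frakA_diffusion : frakA 1 ((2 - h) / h ^+ 3) diffusion.
Proof.
split; last by move=> z _; exact: coef_bounds.
have mp : measurable_fun setT (fun z : R * R => z.1 `^ (- 2^-1)).
  by apply: (measurableT_comp (@measurable_powR R (- 2^-1))); exact: measurable_fst.
apply: measurable_funTS; apply: (measurableT_comp (measurable_coef h)).
by apply: measurable_funM; [exact: measurable_funM|exact: measurable_snd].
Qed.

(** The profile is at least f 1 on [-1, 1], so that u exceeds M on the rectangle of all (t, x) with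
   d/2 < t < d and |x| < r, for d small and r chosen so that |xi| <= 1 there; this rectangle is not
   negligible. *)
Lemma unbounded_sol : unbounded_in_Q sol.
Proof.
move=> [M [N [mN N0 NM]]].
have m0 := profile_gt0 h 1.
pose L := `|M| / profile h 1 + 1.
have L1 : 1 <= L by rewrite lerDr divr_ge0// ltW.
have L0 : 0 < L by rewrite (lt_le_trans _ L1).
(* Solves d^(-h/2) = L. *)
pose d := L `^ (- (h / 2)^-1).
have d0 : 0 < d by exact: powR_gt0.
have d1 : d <= 1.
  have hi : 0 <= (h / 2)^-1 by rewrite invr_ge0 divr_ge0 ?(ltW h0).
  by rewrite /d powRN invf_le1 ?powR_gt0//; have := ler_powR L1 hi; rewrite powRr0.
have dL : d `^ (- (h / 2)) = L.
  by rewrite /d -powRrM mulrNN mulVf ?powRr1 ?(ltW L0)// gt_eqF// divr_gt0.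
pose r := (xscale * (d / 2) `^ (- 2^-1))^-1.
have r0 : 0 < r by rewrite invr_gt0 mulr_gt0 ?xscale_gt0// powR_gt0// divr_gt0.
pose rect : set (R * R) := `]d / 2, d[%classic `*` `]- r, r[%classic.
have mrect : measurable rect by apply: measurableX; exact: measurable_itv.
have rN : rect `<=` N.
  move=> [t x] [/=]; rewrite !in_itv/= => /andP[td1 td2] /andP[xr1 xr2].
  apply: NM => /= H; have t0 : 0 < t by lra.
  have := H; rewrite /Q /= t0 (lt_le_trans td2 d1) => /(_ isT).
  rewrite /sol /cutoff /selfsimilar /= t0 (le_trans (ltW td2) d1) mul1r.
  apply/negP; rewrite -ltNge ger0_norm; last by rewrite mulr_ge0 ?powR_ge0// ltW// profile_gt0.
  apply: (@lt_le_trans _ _ (L * profile h 1)).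
    rewrite /L mulrDl mul1r divfK ?gt_eqF//.
    by rewrite (le_lt_trans (ler_norm M))// ltrDl.
  apply: ler_pM; rewrite ?(ltW L0) ?(ltW m0)//.
    rewrite -dL !powRN lef_pV2 ?posrE ?powR_gt0//.
    by apply: ge0_ler_powR; rewrite ?nnegrE ?divr_ge0 ?(ltW h0) ?(ltW t0) ?(ltW d0) ?(ltW td2).
  have tp : 0 < xscale * t `^ (- 2^-1) by apply: mulr_gt0; [exact: xscale_gt0|exact: powR_gt0].
  have rp : 0 < xscale * (d / 2) `^ (- 2^-1) by rewrite -invr_gt0.
  apply: profile_ge => //; rewrite -ler_norml normrM (gtr0_norm tp).
  have xr : `|x| <= r by rewrite ler_norml !ltW.
  apply: (@le_trans _ _ (xscale * (d / 2) `^ (- 2^-1) * r)).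
    apply: ler_pM => //; first exact: ltW.
    rewrite ler_wpM2l ?(ltW xscale_gt0)// !powRN lef_pV2 ?posrE ?(powR_gt0 _ t0)//.
      by apply: ge0_ler_powR; rewrite ?nnegrE ?(ltW t0) ?(ltW td1)// divr_ge0 ?(ltW d0).
    by apply: powR_gt0; rewrite divr_gt0.
  by rewrite /r divff// gt_eqF.
have : ((@lebesgue_measure R \x @lebesgue_measure R) rect <=
        (@lebesgue_measure R \x @lebesgue_measure R) N)%E.
  by apply: le_measure; [exact: mem_set|exact: mem_set|exact: rN].
have li (a b : R) : a < b -> (@lebesgue_measure R `]a, b[%classic = (b - a)%:E)%E.
  by move=> ab; rewrite lebesgue_measure_itv/= lte_fin ab EFinB.
rewrite [leRHS]N0 product_measure1E; [|exact: measurable_itv|exact: measurable_itv].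
have -> : (@lebesgue_measure R `](d / 2)%R, d[%classic * @lebesgue_measure R `](- r)%R, r[%classic
    = ((d - d / 2) * (r - - r))%:E)%E by rewrite !li//; lra.
by rewrite lee_fin; apply/negP; rewrite -ltNge mulr_gt0//; lra.
Qed.

Lemma nonzero_sol : nonzero_in_Q sol.
Proof.
move=> [N [mN N0 NM]]; apply: unbounded_sol; exists 0, N; split=> // z nz.
by apply: NM => sol0; apply: nz => /sol0 ->; rewrite normr0.
Qed.
End Solution.

(** * Choice of the parameter *)

(** The exponents require h < 3/p - 2 = (3 - 2p)/p; dividing once more by p makes this strict
   and keeps the limits 1 and 0. *)
Definition decay_param (R : realType) (p : R) : R := (3 - 2 * p) / p ^+ 2.

Lemma decay_param_itv (R : realType) (p : R) : 1 < p < 3 / 2 -> 0 < decay_param p < 1.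
Proof.
move=> /andP[p1 p2]; have p0 : 0 < p by lra.
have pp : 0 < p ^+ 2 by rewrite exprn_gt0.
apply/andP; split; first by rewrite divr_gt0//; lra.
by rewrite ltr_pdivrMr// mul1r; nra.
Qed.

Lemma decay_param_exponent (R : realType) (p : R) : 1 < p < 3 / 2 ->
  (decay_param p / 2 + 1) * p < 3 / 2.
Proof.
move=> /andP[p1 p2]; have p0 : 0 < p by lra.
have -> : (decay_param p / 2 + 1) * p = (3 - 2 * p + 2 * p ^+ 2) / (2 * p).
  by rewrite /decay_param; field; rewrite gt_eqF.
by rewrite ltr_pdivrMr ?mulr_gt0//; nra.
Qed.

Lemma cvg_decay_param (R : realType) (p : R) : 0 < p -> decay_param q @[q --> p] --> decay_param p.
Proof.
move=> p0; have cp : (q : R) @[q --> p] --> p by exact: cvg_id.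
apply: cvgM; first by apply: cvgB; [exact: cvg_cst|apply: cvgM; [exact: cvg_cst|exact: cp]].
apply: cvgV; first by rewrite expf_neq0// gt_eqF.
exact: (cvgM cp cp).
Qed.

Unset Implicit Arguments.

Theorem theorem2p1 (R : realType) :
  exists alpha : R -> R,
    [/\ (forall p : R, 1 < p < 3 / 2 -> 1 < alpha p),
        (forall p : R, 1 < p < 3 / 2 ->
           exists2 a : R * R -> R, frakA 1 (alpha p) a &
           exists u : R * R -> R,
             [/\ W12_0_Q p u, solves_in_Q a u,
                 nonzero_in_Q u & unbounded_in_Q u]),
        alpha p @[p --> 1^'+] --> (1 : R) &
        alpha p @[p --> (3 / 2)^'-] --> +oo].
Proof.
exists (fun p => (2 - decay_param p) / decay_param p ^+ 3); split.
- move=> p /decay_param_itv; set h := decay_param p => /andP[h0 h1].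
  rewrite ltr_pdivlMr ?exprn_gt0// mul1r.
  have h3 : h ^+ 3 < 1 by rewrite exprn_ilt1// ltW.
  lra.
- move=> p p32; have h01 := decay_param_itv p32.
  exists (diffusion (decay_param p)); first exact: frakA_diffusion.
  exists (sol (decay_param p)); split.
  + apply: W12_0_Q_sol => //; first by case/andP: p32 => /ltW.
    exact: decay_param_exponent.
  + exact: solves_sol.
  + exact: nonzero_sol.
  + exact: unbounded_sol.
- have d1 : decay_param 1 = 1 :> R by rewrite /decay_param; field.
  apply: cvg_at_right_filter.
  have cd := @cvg_decay_param R 1 ltr01; rewrite d1 in cd.
  rewrite [X in _ --> X](_ : _ = (2 - 1) / 1 ^+ 3); last by field.
  apply: cvgM; first by apply: cvgB; [exact: cvg_cst|exact: cd].
  by apply: cvgV; [rewrite expr1n oner_neq0|exact: (cvgM cd (cvgM cd cd))].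
- have d1 : decay_param (3 / 2) = 0 :> R by rewrite /decay_param; field.
  have cd : decay_param q @[q --> (3 / 2)^'-] --> (0 : R).
    by rewrite -d1; apply: cvg_at_left_filter; apply: cvg_decay_param; lra.
  apply/cvgryPge => A.
  have A1 : 0 < (`|A| + 1)^-1 by rewrite invr_gt0 ltr_wpDl.
  near=> p.
  have pI : 1 < p < 3 / 2.
    by apply/andP; split; near: p; [apply: nbhs_left_gt; lra|exact: nbhs_left_lt].
  have /andP[h0 h1] := decay_param_itv pI.
  have hA : decay_param p < (`|A| + 1)^-1 by near: p; exact: (cvgr_lt _ cd _ A1).
  move: (decay_param p) h0 h1 hA => h h0 h1 hA.
  have Ah : A * h <= 1.
    have : h * (`|A| + 1) < 1 by rewrite -ltr_pdivlMr ?ltr_wpDl// mul1r.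
    by have := ler_norm A; nra.
  rewrite ler_pdivlMr ?exprn_gt0//.
  have -> : A * h ^+ 3 = A * h * h ^+ 2 by ring.
  have h2 : h ^+ 2 <= 1 by rewrite exprn_ile1// ltW.
  apply: (@le_trans _ _ (1 * h ^+ 2)); first by rewrite ler_wpM2r// sqr_ge0.
  lra.
Unshelve. all: by end_near. Qed.
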